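(* Let $n\ge2$, $c>0$, and let $\gamma_{2n,1},\dots,\gamma_{2n,n}$ be real. With $\Psi_{\boldsymbol\gamma_{2m}}(x_1,\dots,x_m)$ the $B_m$ Whittaker function defined in the context, one has the iterative formula $$\Psi_{\boldsymbol\gamma_{2n}}(x_1,\dots,x_n)=\int_{\mathbb R^{n-1}}K(\boldsymbol\gamma_{2n};\boldsymbol\gamma_{2n-2}|x_n)\,\Psi_{\boldsymbol\gamma_{2n-2}}(x_1-x_n,\dots,x_{n-1}-x_n)\,\mu(\boldsymbol\gamma_{2n-2})\,d\boldsymbol\gamma_{2n-2},$$ where $$K(\boldsymbol\gamma_{2n};\boldsymbol\gamma_{2n-2}|x)=e^{\frac{n(n-1)}2x}\int_{\mathbb R^n}\mu(\boldsymbol\gamma_{2n-1})\,d\boldsymbol\gamma_{2n-1}\;c^{\frac2{ic}\delta_{2n-1}}e^{-\frac{\delta_{2n-1}}{ic}x}$$ $$\times\prod_{p=1}^{n-1}\prod_{l=1}^n\Gamma\Big(\frac{\pm\gamma_{2n-2,p}-\gamma_{2n-1,l}}{ic}+\frac12\Big)\prod_{p,j=1}^n\Gamma\Big(\frac{\pm\gamma_{2n,p}+\gamma_{2n-1,j}}{ic}+\frac12\Big).$$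
   Context: Here $i=\sqrt{-1}$, all $x_k$ are real. For $a\ge1$, $\boldsymbol\gamma_{2k}=(\gamma_{2k,1},\dots,\gamma_{2k,k})$, $\boldsymbol\gamma_{2k-1}=(\gamma_{2k-1,1},\dots,\gamma_{2k-1,k})$; $\delta_a=\sum_j\gamma_{a,j}$, $\delta_{-1}=0$; $d\boldsymbol\gamma_a=\prod_j d\gamma_{a,j}$. A sign $\pm$ inside a Gamma function means the product over both signs: $\Gamma(\pm a+b)=\Gamma(a+b)\Gamma(-a+b)$. The measure functions are $$\mu(\boldsymbol\gamma_{2k})=\prod_{r<s}\Big|\Gamma\Big(\frac{\gamma_{2k,r}-\gamma_{2k,s}}{ic}\Big)\Big|^{-2}\Big|\Gamma\Big(\frac{\gamma_{2k,r}+\gamma_{2k,s}}{ic}\Big)\Big|^{-2}\prod_r\Big|\Gamma\Big(\frac{2\gamma_{2k,r}}{ic}\Big)\Big|^{-2},$$ $$\mu(\boldsymbol\gamma_{2k+1})=\prod_{r<s}\Big|\Gamma\Big(\frac{\gamma_{2k+1,r}-\gamma_{2k+1,s}}{ic}\Big)\Big|^{-2}\Big|\Gamma\Big(1+\frac{\gamma_{2k+1,r}+\gamma_{2k+1,s}}{ic}\Big)\Big|^{-2}.$$ For $m\ge1$ and real $\gamma_{2m,1},\dots,\gamma_{2m,m}$ the Whittaker function is the (absolutely convergent) integral over real $\gamma_{a,j}$, $1\le a\le 2m-1$: $$\Psi_{\boldsymbol\gamma_{2m}}(x_1,\dots,x_m)=\int_{\mathbb R^{m^2}}\prod_{a=1}^{2m-1}\mu(\boldsymbol\gamma_a)\,d\boldsymbol\gamma_a\;c^{\frac2{ic}\sum_{k=1}^m\delta_{2k-1}}\,e^{\frac1{ic}\sum_{k=1}^m(\delta_{2k-3}-\delta_{2k-1}+(k-1)ic)x_k}$$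 $$\times\prod_{k=1}^{m-1}\prod_{p=1}^k\Big[\prod_{j=1}^k\Gamma\Big(\frac{\pm\gamma_{2k,p}+\gamma_{2k-1,j}}{ic}+\frac12\Big)\prod_{l=1}^{k+1}\Gamma\Big(\frac{\pm\gamma_{2k,p}-\gamma_{2k+1,l}}{ic}+\frac12\Big)\Big]\prod_{p,j=1}^m\Gamma\Big(\frac{\pm\gamma_{2m,p}+\gamma_{2m-1,j}}{ic}+\frac12\Big).$$ *)

(* Defs.v *)
From HB Require Import structures.
From mathcomp Require Import all_boot all_order all_algebra.
From mathcomp Require Import complex.
From mathcomp Require Import all_classical all_reals all_analysis.

Set Implicit Arguments.
Unset Strict Implicit.
Unset Printing Implicit Defensive.

Import Order.TTheory GRing.Theory Num.Theory numFieldNormedType.Exports.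

Local Open Scope classical_set_scope.
Local Open Scope complex_scope.
Local Open Scope ring_scope.

Section lebesgue_tuple.
Context {R : realType}.

Definition cons_pair (n : nat) (p : R * n.-tuple R) : n.+1.-tuple R :=
  [the n.+1.-tuple R of p.1 :: p.2].

Lemma measurable_cons_pair (n : nat) : measurable_fun setT (@cons_pair n).
Proof. exact: measurable_cons. Qed.

Section step.
Context (n : nat) (mu : {sigma_finite_measure set (n.-tuple R) -> \bar R}).

Definition lebesgue_tupleS : set (n.+1.-tuple R) -> \bar R :=
  pushforward (lebesgue_measure \x mu)%E (@cons_pair n).

Let measurable_preimage (A : set (n.+1.-tuple R)) :
  measurable A -> measurable (@cons_pair n @^-1` A).
Proof. by move=> mA; rewrite -[X in measurable X]setTI; exact: measurable_cons_pair. Qed.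

Let lebesgue_tupleS0 : lebesgue_tupleS set0 = 0%E.
Proof. by rewrite /lebesgue_tupleS /pushforward preimage_set0 measure0. Qed.

Let lebesgue_tupleS_ge0 A : (0 <= lebesgue_tupleS A)%E.
Proof. by apply: integral_ge0 => x _; exact: measure_ge0. Qed.

Let lebesgue_tupleS_sigma_additive : semi_sigma_additive lebesgue_tupleS.
Proof.
move=> F mF tF mUF; rewrite /lebesgue_tupleS /pushforward preimage_bigcup.
apply: (@measure_semi_sigma_additive _ _ _ (lebesgue_measure \x mu)%E).
- by move=> k; exact: measurable_preimage.
- apply/trivIsetP => /= i j _ _ ij; rewrite -preimage_setI.
  by move/trivIsetP : tF => /(_ _ _ _ _ ij) ->//; rewrite preimage_set0.
- by rewrite -preimage_bigcup; exact: measurable_preimage.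
Qed.

HB.instance Definition _ := isMeasure.Build _ _ _ lebesgue_tupleS
  lebesgue_tupleS0 lebesgue_tupleS_ge0 lebesgue_tupleS_sigma_additive.

Let lebesgue_tupleS_sigma_finite : sigma_finite setT lebesgue_tupleS.
Proof.
have /sigma_finiteP[F [TF ndF Ffin]] := sigma_finiteT (@lebesgue_measure R).
have /sigma_finiteP[G [TG ndG Gfin]] := sigma_finiteT mu.
pose uncons (u : n.+1.-tuple R) := (thead u, [tuple of behead u] : n.-tuple R).
have consK : cancel uncons (@cons_pair n).
  by move=> u; apply: val_inj; rewrite /= [u in RHS]tuple_eta.
have unconsK : cancel (@cons_pair n) uncons.
  by move=> [x v]; congr pair; apply: val_inj.
have muncons : measurable_fun setT uncons.
  apply/measurable_fun_pair; first exact: measurable_tnth.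
  exact: measurable_behead.
exists (fun k => uncons @^-1` (F k `*` G k)).
  apply/esym; rewrite -subTset => u _.
  have [i _ Fi] : (\bigcup_i F i) (uncons u).1 by rewrite -TF.
  have [j _ Gj] : (\bigcup_i G i) (uncons u).2 by rewrite -TG.
  exists (maxn i j) => //; split.
  - by move: Fi; exact/subsetPset/ndF/leq_maxl.
  - by move: Gj; exact/subsetPset/ndG/leq_maxr.
move=> k; have [mF Fk] := Ffin k; have [mG Gk] := Gfin k; split.
  by rewrite -[X in measurable X]setTI; apply: muncons => //; exact: measurableX.
rewrite /lebesgue_tupleS /pushforward.
rewrite (_ : _ @^-1` _ = F k `*` G k); last first.
  by apply/funext => p; exact: (congr1 (F k `*` G k) (unconsK p)).
by rewrite product_measure1E// lte_mul_pinfty// ge0_fin_numE.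
Qed.

HB.instance Definition _ := Measure_isSigmaFinite.Build _ _ _ lebesgue_tupleS
  lebesgue_tupleS_sigma_finite.

End step.

(* n-fold product of the Lebesgue measure, on n.-tuple R seen as R^n *)
Fixpoint lebesgue_tuple (n : nat) :
    {sigma_finite_measure set (n.-tuple R) -> \bar R} :=
  match n with
  | 0 => [the {sigma_finite_measure set (0.-tuple R) -> \bar R} of
           dirac [tuple]]
  | n'.+1 => [the {sigma_finite_measure set (n'.+1.-tuple R) -> \bar R} of
               lebesgue_tupleS (lebesgue_tuple n')]
  end.

End lebesgue_tuple.
Arguments lebesgue_tuple : clear implicits.

Section complex_functions.
Context {R : realType}.
Implicit Types (z : R[i]) (x : R).

Definition Cexp z : R[i] := (expR (complex.Re z))%:C * (cos (complex.Im z) +i* sin (complex.Im z)).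

(* Gauss' limit formula; the quotient is total, so that Gamma is 0 at the
   poles 0, -1, -2, etc. and `|Gamma z| ^- 2 is then 0 as well, which is the
   value at z of the entire function 1 / Gamma. *)
Definition Gamma z : R[i] :=
  limn ((fun n : nat => n`!%:R * Cexp (z * (ln n%:R)%:C) /
                        \prod_(j < n.+1) (z + j%:R)) : nat -> (R[i] : numFieldType)).

(* Gamma(+-a + b) *)
Definition Gamma_pm (a b : R[i]) : R[i] := Gamma (a + b) * Gamma (- a + b).

(* x to the power z, for x > 0 *)
Definition Cpow x z : R[i] := Cexp (z * (ln x)%:C).

Definition Cintegral d (T : measurableType d) (mu : {measure set T -> \bar R})
    (f : T -> R[i]) : R[i] :=
  (\int[mu]_t complex.Re (f t)) +i* (\int[mu]_t complex.Im (f t)).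

End complex_functions.

(* The coordinates of gamma_a are indexed from 0: gamma_{a,j} is g`_j.-1. *)
Section Whittaker.
Context {R : realType}.
Variable c : R.
Implicit Types (g h x : seq R) (a k m n : nat).

Local Notation ic := (0 +i* c).

Definition mu_even k g : R[i] :=
  (\prod_(s < k) \prod_(r < s)
     (`|Gamma ((g`_r - g`_s)%:C / ic)| ^- 2 *
      `|Gamma ((g`_r + g`_s)%:C / ic)| ^- 2)) *
  \prod_(r < k) `|Gamma ((2%:R * g`_r)%:C / ic)| ^- 2.

Definition mu_odd k g : R[i] :=
  \prod_(s < k.+1) \prod_(r < s)
    (`|Gamma ((g`_r - g`_s)%:C / ic)| ^- 2 *
     `|Gamma (1 + (g`_r + g`_s)%:C / ic)| ^- 2).

Definition mufun a g : R[i] := if odd a then mu_odd a./2 g else mu_even a./2 g.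

Definition delta g : R := \sum_(y <- g) y.

(* Gamma((+- u + v) / (ic) + 1/2) *)
Definition Gamma_half (u v : R) : R[i] :=
  Gamma_pm (u%:C / ic) (v%:C / ic + 2%:R^-1).

(* The point (gamma_1, ..., gamma_{2m-1}) of R^(m^2) is laid out level after
   level: level a has uphalf a coordinates, and the levels 1, ..., a - 1 take
   up the first a./2 * uphalf a of them. Level 0 is empty. *)
Definition level g a : seq R := take (uphalf a) (drop (a./2 * uphalf a) g).

Definition Whittaker_integrand m (g2m x : m.-tuple R) (t : (m ^ 2).-tuple R) :
    R[i] :=
  let gamma := level t in
  let deltap k : R := if k is k'.+1 then delta (gamma (k'.*2.+1)) else 0 in
  (* deltap k is delta_{2k-1}, with delta_{-1} = 0 *)
  (\prod_(1 <= a < m.*2) mufun a (gamma a)) *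
  Cpow c (2%:R / ic * (\sum_(1 <= k < m.+1) deltap k)%:C) *
  Cexp (ic^-1 * \sum_(1 <= k < m.+1)
    (((deltap k.-1 - deltap k)%:C + k.-1%:R * ic) * (x`_k.-1)%:C)) *
  (\prod_(1 <= k < m) \prod_(p < k)
     ((\prod_(j < k) Gamma_half (gamma k.*2)`_p (gamma k.*2.-1)`_j) *
      \prod_(l < k.+1) Gamma_half (gamma k.*2)`_p (- (gamma k.*2.+1)`_l))) *
  \prod_(p < m) \prod_(j < m) Gamma_half g2m`_p (gamma m.*2.-1)`_j.

Definition Whittaker m (g2m x : m.-tuple R) : R[i] :=
  Cintegral (lebesgue_tuple R (m ^ 2)) (Whittaker_integrand g2m x).

Definition Whittaker_kernel n (g2n : n.-tuple R) (g2n2 : (n.-1).-tuple R) (y : R) : R[i] :=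
  (expR ((n * n.-1)%:R / 2%:R * y))%:C *
  Cintegral (lebesgue_tuple R n) (fun h : n.-tuple R =>
    mufun n.*2.-1 h *
    Cpow c (2%:R / ic * (delta h)%:C) *
    Cexp (- ((delta h)%:C / ic) * y%:C) *
    (\prod_(p < n.-1) \prod_(l < n) Gamma_half g2n2`_p (- h`_l)) *
    \prod_(p < n) \prod_(j < n) Gamma_half g2n`_p h`_j).

End Whittaker.

(* Main.v *)
Require Import Defs.
From mathcomp Require Import all_boot all_order all_algebra.
From mathcomp Require Import complex.
From mathcomp Require Import all_classical all_reals all_analysis.
From mathcomp Require Import measurable_realfun.
From mathcomp Require Import ring lra zify.
Set Implicit Arguments.
Unset Strict Implicit.
Unset Printing Implicit Defensive.
Import Order.TTheory GRing.Theory Num.Theory numFieldNormedType.Exports.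
Local Open Scope classical_set_scope.
Local Open Scope complex_scope.
Local Open Scope ring_scope.

(**
  The recursion is Fubini's theorem for the integral defining the Whittaker
  function, once its integrand is split along the variables of the levels
  below 2n-2, of level 2n-2 and of level 2n-1. The content is absolute
  convergence.

  On the lines Re z = 0, 1/2, 1 the modulus of Gamma is controlled by
  prod_j (1 + y^2 / j^2) = exp (pi |y| + O(log |y|)). Since
  |a - b| + |a + b| = 2 max (|a|, |b|), up to an arbitrarily small exponential
  loss the logarithm of the integrand is pi / c times a combination of the sums
  E(S, T) = sum_(s in S, t in T) max (|s|, |t|) over the levels S, T. With
  max (s, t) = s + t - min (s, t) all linear terms cancel, and what remains is
  -1/2 times a sum, over consecutive levels, of the squared distances
  D(S, T) = M(S, S) - 2 M(S, T) + M(T, T) for the positive semidefinite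
  kernel min, where M(S, T) = sum_(s in S, t in T) min (|s|, |t|). As
  D(S, T) >= |max |S| - max |T|| and level 0 is empty, the integrand decays
  exponentially in all variables.
*)

(** The linear terms cancel by a count of coordinates: the measure of a level gives each [|s|] of
    that level a coefficient equal to the number of coordinates in the two adjacent levels, and the
    Gamma factors linking it to those levels subtract exactly as much. Only level [2m] is
    unbalanced; it consists of fixed parameters. The exponential loss does not cancel, since it
    enters with the same sign from the measures and from the Gamma factors. It is however at most
    linear in the largest coordinate, as the decay is, so a small enough rate of loss costs only
    half of the decay. What is left of the decay is traded for a product of factors [1 / (1 + x^2)].
    This dominating function splits over the coordinates, so every slice of the integrand is
    integrable, not just almost every one, and the inner integrals can be factored at each value of
    the variables of level [2n-2]. *)

Local Notation normc := ComplexField.Normc.normc.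

(** * Measurability of complex-valued functions *)

Section measurability.
Context {R : realType} d (T : measurableType d).
Implicit Types f g : T -> R[i].

(** The inverse is [h] times the power [-1] of the nonnegative function [h ^+ 2], and powers are
    measurable. With the total inverse, both sides are 0 where [h] vanishes. *)
Lemma measurable_funV (h : T -> R) :
  measurable_fun setT h -> measurable_fun setT (fun t => (h t)^-1).
Proof.
move=> mh; rewrite (_ : (fun t => _) = (fun t => h t * (h t ^+ 2) `^ (-1))).
  apply: measurable_funM => //.
  by apply: (measurableT_comp (measurable_powR (-1))); exact: measurable_funX.
apply/funext => t; rewrite powR_inv1 ?sqr_ge0//.
have [->|h0] := eqVneq (h t) 0; first by rewrite invr0 mul0r.
by rewrite expr2 invfM mulrA divff// mul1r.
Qed.

Definition cmeasurable f :=
  measurable_fun setT (fun t => complex.Re (f t)) /\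
  measurable_fun setT (fun t => complex.Im (f t)).

Lemma cmeasurable_real (h : T -> R) :
  measurable_fun setT h -> cmeasurable (fun t => (h t)%:C).
Proof. by move=> mh; split => //=; exact: measurable_cst. Qed.

Lemma cmeasurable_cst z : cmeasurable (fun=> z).
Proof. by split; exact: measurable_cst. Qed.

Lemma cmeasurableD f g :
  cmeasurable f -> cmeasurable g -> cmeasurable (fun t => f t + g t).
Proof.
move=> [mf mf'] [mg mg']; split.
- rewrite (_ : (fun t => _) =
    (fun t => complex.Re (f t) + complex.Re (g t))); last first.
    by apply/funext => t; case: (f t) => ? ?; case: (g t).
  exact: measurable_funD.
- rewrite (_ : (fun t => _) =
    (fun t => complex.Im (f t) + complex.Im (g t))); last first.
    by apply/funext => t; case: (f t) => ? ?; case: (g t).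
  exact: measurable_funD.
Qed.

Lemma cmeasurableM f g :
  cmeasurable f -> cmeasurable g -> cmeasurable (fun t => f t * g t).
Proof.
move=> [mf mf'] [mg mg']; split.
- rewrite (_ : (fun t => _) = (fun t => complex.Re (f t) * complex.Re (g t) -
    complex.Im (f t) * complex.Im (g t))); last first.
    by apply/funext => t; case: (f t) => ? ?; case: (g t).
  by apply: measurable_funB; exact: measurable_funM.
- rewrite (_ : (fun t => _) = (fun t => complex.Re (f t) * complex.Im (g t) +
    complex.Im (f t) * complex.Re (g t))); last first.
    by apply/funext => t; case: (f t) => ? ?; case: (g t).
  by apply: measurable_funD; exact: measurable_funM.
Qed.

Lemma cmeasurableN f : cmeasurable f -> cmeasurable (fun t => - f t).
Proof.
move=> mf; rewrite (_ : (fun t => _) = (fun t => (-1) * f t)).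
  by apply: cmeasurableM => //; exact: cmeasurable_cst.
by apply/funext => t; rewrite mulN1r.
Qed.

Lemma measurable_Re2_Im2 f : cmeasurable f ->
  measurable_fun setT (fun t => (complex.Re (f t)) ^+ 2 + (complex.Im (f t)) ^+ 2).
Proof. by move=> [mf mf']; apply: measurable_funD; exact: measurable_funX. Qed.

Lemma cmeasurable_normV2 f : cmeasurable f -> cmeasurable (fun t => `|f t| ^- 2).
Proof.
move=> /measurable_Re2_Im2/measurable_funV/cmeasurable_real mf.
rewrite (_ : (fun t => _) = (fun t =>
  ((complex.Re (f t) ^+ 2 + complex.Im (f t) ^+ 2)^-1)%:C)) //.
by apply/funext => t; rewrite -add_Re2_Im2 fmorphV.
Qed.

Lemma cmeasurableV f : cmeasurable f -> cmeasurable (fun t => (f t)^-1).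
Proof.
move=> mf; rewrite (_ : (fun t => _) = (fun t => `|f t| ^- 2 * (f t)^*%C)); last first.
  by apply/funext => t; rewrite -invc_norm.
apply: cmeasurableM; first exact: cmeasurable_normV2.
case: mf => mr mi; split.
  by rewrite (_ : (fun t => _) = (fun t => complex.Re (f t)))//;
    apply/funext => t; case: (f t).
rewrite (_ : (fun t => _) = (fun t => - complex.Im (f t))); first exact: measurable_funN.
by apply/funext => t; case: (f t).
Qed.

Lemma cmeasurable_sum I (s : seq I) (P : pred I) (f : I -> T -> R[i]) :
  (forall i, P i -> cmeasurable (f i)) ->
  cmeasurable (fun t => \sum_(i <- s | P i) f i t).
Proof.
move=> mf; elim: s => [|i s IH].
  rewrite (_ : (fun t => _) = fun=> 0); first exact: cmeasurable_cst.
  by apply/funext => t; rewrite big_nil.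
case Pi : (P i); last first.
  by rewrite (_ : (fun t => _) = fun t => \sum_(i <- s | P i) f i t) //;
    apply/funext => t; rewrite big_cons Pi.
rewrite (_ : (fun t => _) = fun t => f i t + \sum_(i <- s | P i) f i t).
  by apply: cmeasurableD; [exact: mf|exact: IH].
by apply/funext => t; rewrite big_cons Pi.
Qed.

Lemma cmeasurable_prod I (s : seq I) (P : pred I) (f : I -> T -> R[i]) :
  (forall i, P i -> cmeasurable (f i)) ->
  cmeasurable (fun t => \prod_(i <- s | P i) f i t).
Proof.
move=> mf; elim: s => [|i s IH].
  rewrite (_ : (fun t => _) = fun=> 1); first exact: cmeasurable_cst.
  by apply/funext => t; rewrite big_nil.
case Pi : (P i); last first.
  by rewrite (_ : (fun t => _) = fun t => \prod_(i <- s | P i) f i t) //;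
    apply/funext => t; rewrite big_cons Pi.
rewrite (_ : (fun t => _) = fun t => f i t * \prod_(i <- s | P i) f i t).
  by apply: cmeasurableM; [exact: mf|exact: IH].
by apply/funext => t; rewrite big_cons Pi.
Qed.

Lemma cmeasurable_Cexp f : cmeasurable f -> cmeasurable (fun t => Cexp (f t)).
Proof.
move=> [mf mf']; apply: cmeasurableM.
  by apply: cmeasurable_real; exact: measurableT_comp.
split => /=; apply: measurableT_comp => //; apply: continuous_measurable_fun.
  exact: continuous_cos.
exact: continuous_sin.
Qed.

(** Convergence in the reals means that the upper and lower limits, measurable as extended real
    functions, are finite and equal. *)
Lemma measurable_cvgn (u : nat -> T -> R) :
  (forall n, measurable_fun setT (u n)) ->
  measurable_fun setT (fun t => `[< cvgn (u ^~ t) >]).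
Proof.
move=> mu.
pose L t := limn_esup (fun n => (u n t)%:E).
pose l t := limn_einf (fun n => (u n t)%:E).
have mL : measurable_fun setT L.
  by apply: measurable_fun_limn_esup => n; exact/measurable_EFinP.
have ml : measurable_fun setT l.
  apply: measurableT_comp => //.
  apply: (@measurable_fun_limn_esup _ _ _ _ (fun n t => - (u n t)%:E)%E) => n.
  by apply: measurableT_comp => //; exact/measurable_EFinP.
have fin_numb (h : T -> \bar R) : measurable_fun setT h ->
    measurable_fun setT (fun t => h t \is a fin_num).
  move=> mh; apply: (@measurable_fun_bool _ _ _ _ true).
  exact: (emeasurable_fin_num measurableT mh).
rewrite (_ : (fun t => _) = (fun t =>
  [&& L t \is a fin_num, l t \is a fin_num & fine (L t) == fine (l t)])).
  apply: measurable_and; first exact: fin_numb.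
  apply: measurable_and; first exact: fin_numb.
  by apply: measurable_fun_eqr; exact: measurableT_comp.
apply/funext => t; apply/idP/idP => [/asboolP/cvg_ex[a ua]|/and3P[fL fl /eqP Ll]].
  have ua' : (fun n => (u n t)%:E) @ \oo --> a%:E.
    by apply: cvg_EFin; [exact: nearW|exact: ua].
  have [h1 h2] := cvg_limn_einf_sup ua'.
  by rewrite /L /l h1 h2 /= eqxx.
apply/asboolP.
have LlE : L t = l t by rewrite -(fineK fL) -(fineK fl) Ll.
have : (fun n => (u n t)%:E) @ \oo --> (fine (L t))%:E.
  rewrite fineK//; apply: (@squeeze_cvge _ _ _ _
    (einfs (fun n => (u n t)%:E)) _ (esups (fun n => (u n t)%:E))).
  - near=> n; apply/andP; split.
      by apply: ereal_inf_lbound; exists n => /=.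
    by apply: ereal_sup_ubound; exists n => /=.
  - by rewrite LlE /l limn_einf_lim; exact: is_cvg_einfs.
  - by rewrite /L limn_esup_lim; exact: is_cvg_esups.
move=> /fine_cvg /= ut; apply/cvg_ex; exists (fine (L t)).
exact: ut.
Unshelve. all: by end_near. Qed.

Lemma measurable_limn (u : nat -> T -> R) :
  (forall n, measurable_fun setT (u n)) ->
  measurable_fun setT (fun t => if `[< cvgn (u ^~ t) >] then limn (u ^~ t) else 0).
Proof.
move=> mu; rewrite (_ : (fun t => _) = (fun t => if `[< cvgn (u ^~ t) >] then
   fine (limn_esup (fun n => (u n t)%:E)) else 0)).
  apply: measurable_fun_ifT => //; first exact: measurable_cvgn.
  apply: measurableT_comp => //.
  by apply: measurable_fun_limn_esup => n; exact/measurable_EFinP.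
apply/funext => t; case: asboolP => // ut.
have ua' : (fun n => (u n t)%:E) @ \oo --> (limn (u ^~ t))%:E.
  by apply: cvg_EFin; [exact: nearW|exact: ut].
by have [_ ->] := cvg_limn_einf_sup ua'.
Qed.

End measurability.

Section complex_limits.
Context {R : realType}.
Implicit Types u : nat -> R[i].

Lemma cvg_complexP u (l : R[i]) :
  (u : nat -> (R[i] : numFieldType)) @ \oo --> (l : (R[i] : numFieldType)) <->
  (fun n => complex.Re (u n)) @ \oo --> complex.Re l /\
  (fun n => complex.Im (u n)) @ \oo --> complex.Im l.
Proof.
split=> [ul|[ur ui]].
  have H e : 0 < e -> \forall n \near \oo, `|l - u n| <= e%:C.
    move=> e0; move/cvgrPdist_le : ul; apply.
    by rewrite ltcR.
  split; apply/cvgrPdist_le => e e0; near=> n.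
    have := le_trans (normc_ge_Re (l - u n)) _.
    move=> /(_ e%:C) h; rewrite -lecR.
    rewrite (_ : complex.Re l - _ = complex.Re (l - u n)); last first.
      by case: (l) => ? ?; case: (u n).
    by apply: h; near: n; exact: H.
  (* [Im w = - Re (w * 'i)] and ['i] has modulus 1, so the bound of the real part by the modulus
     also serves for the imaginary part. *)
  have := le_trans (normc_ge_Re ((l - u n) * 'i)) _.
  move=> /(_ e%:C) h; rewrite -lecR.
  rewrite (_ : complex.Im l - _ = - complex.Re ((l - u n) * 'i)); last first.
    by case: (l) => ? ?; case: (u n) => ? ? /=; rewrite mulr0 sub0r mulr1 opprK.
  rewrite normrN; apply: h.
  rewrite normrM (_ : `|'i| = 1) ?mulr1; first by near: n; exact: H.
  by rewrite normc_def /= expr0n add0r expr1n sqrtr1.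
apply/cvgrPdist_le => e e0.
have eE : e = (complex.Re e)%:C.
  by case: e e0 => a b; rewrite ltcE /= => /andP[/eqP-> _].
move: e0; rewrite eE ltcR; set a := complex.Re e => a0.
near=> n.
rewrite (_ : l - u n = (complex.Re l - complex.Re (u n))%:C +
   'i * (complex.Im l - complex.Im (u n))%:C); last first.
  by case: (l) => x y; case: (u n) => x' y' /=; apply/eqP; rewrite eq_complex /=;
    rewrite !(mul0r, mul1r, mulr0, subr0, addr0, add0r, oppr0) !eqxx.
apply: (le_trans (ler_normD _ _)).
rewrite normrM (_ : `|'i| = 1) ?mul1r; last first.
  by rewrite normc_def /= expr0n add0r expr1n sqrtr1.
have nR (x : R) : `|x%:C| = `|x|%:C.
  by rewrite normc_def /= expr0n addr0 sqrtr_sqr.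
rewrite !nR -rmorphD lecR [leRHS]splitr; apply: lerD.
  near: n; move/cvgrPdist_le : ur; apply; exact: divr_gt0.
near: n; move/cvgrPdist_le : ui; apply; exact: divr_gt0.
Unshelve. all: by end_near. Qed.

(** A divergent sequence has the default limit 0, and one divergent component is enough to make both
    components of the limit 0; hence the joint test. It yields the measurability of [Gamma] whether
    or not Gauss' sequence converges. *)
Lemma limn_complexE u : limn (u : nat -> (R[i] : numFieldType)) =
  if `[< cvgn (fun n => complex.Re (u n)) >] && `[< cvgn (fun n => complex.Im (u n)) >]
  then limn (fun n => complex.Re (u n)) +i* limn (fun n => complex.Im (u n)) else 0.
Proof.
case: ifPn => [/andP[/asboolP ur /asboolP ui]|h].
  have : cvgn (u : nat -> (R[i] : numFieldType)).
    apply/cvg_ex; exists (limn (fun n => complex.Re (u n)) +i*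
      limn (fun n => complex.Im (u n))).
    by apply/cvg_complexP; split; [exact: ur|exact: ui].
  move/cvg_complexP => [/cvg_lim -> // /cvg_lim -> //].
  by case: (limn _).
apply: dvgP => /cvg_ex[l /cvg_complexP[ur ui]].
by move: h; rewrite negb_and => /orP[] /asboolP; apply; apply/cvg_ex; eexists;
  [exact: ur|exact: ui].
Qed.

Lemma cmeasurable_limn d (T : measurableType d) (u : nat -> T -> R[i]) :
  (forall n, cmeasurable (u n)) ->
  cmeasurable (fun t => limn (u ^~ t : nat -> (R[i] : numFieldType))).
Proof.
move=> mu; split.
  rewrite (_ : (fun t => _) = (fun t =>
    if `[< cvgn (fun n => complex.Im (u n t)) >] then
    if `[< cvgn (fun n => complex.Re (u n t)) >] then
    limn (fun n => complex.Re (u n t)) else 0 else 0)).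
    apply: measurable_fun_ifT => //.
      by apply: measurable_cvgn => n; case: (mu n).
    by apply: measurable_limn => n; case: (mu n).
  apply/funext => t; rewrite limn_complexE.
  by case: asboolP => _; case: asboolP.
rewrite (_ : (fun t => _) = (fun t =>
    if `[< cvgn (fun n => complex.Re (u n t)) >] then
    if `[< cvgn (fun n => complex.Im (u n t)) >] then
    limn (fun n => complex.Im (u n t)) else 0 else 0)).
  apply: measurable_fun_ifT => //.
    by apply: measurable_cvgn => n; case: (mu n).
  by apply: measurable_limn => n; case: (mu n).
apply/funext => t; rewrite limn_complexE.
by case: asboolP => _; case: asboolP.
Qed.

Lemma cmeasurable_Gamma d (T : measurableType d) (f : T -> R[i]) :
  cmeasurable f -> cmeasurable (fun t => Gamma (f t)).
Proof.
move=> mf; apply: cmeasurable_limn => n; apply: cmeasurableM.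
  apply: cmeasurableM; first exact: cmeasurable_cst.
  by apply: cmeasurable_Cexp; apply: cmeasurableM => //; exact: cmeasurable_cst.
apply: cmeasurableV; apply: cmeasurable_prod => i _.
by apply: cmeasurableD => //; exact: cmeasurable_cst.
Qed.

End complex_limits.

(** * The product of the factors 1 + y^2 / j^2 *)

Section sinh_product.
Context {R : realType}.
Implicit Types (y t : R) (n : nat).

(** Partial products of Euler's product for [sinh (pi y) / (pi y)]. *)
Definition sinhprod n y : R := \prod_(j < n) (1 + y ^+ 2 / (j.+1)%:R ^+ 2).

Lemma sinhprod_gt0 n y : 0 < sinhprod n y.
Proof.
apply: prodr_gt0 => j _; apply: (lt_le_trans ltr01).
by rewrite lerDl divr_ge0 ?sqr_ge0.
Qed.

Lemma sinhprod_norm n y : sinhprod n `|y| = sinhprod n y.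
Proof. by apply: eq_bigr => j _; rewrite real_normK// num_real. Qed.

(** Found by integrating [ln (t ^+ 2 + y ^+ 2) - 2 * ln t] by parts. For [y > 0], as [t] grows, the
    first term tends to 0 and the second to [pi * y]: this is the origin of the exponent
    [pi |y|]. *)
Definition sinhprim y t : R :=
  t * (ln (t ^+ 2 + y ^+ 2) - 2 * ln t) + 2 * y * atan (t / y).

Lemma is_derive_sinhprim y t : 0 < y -> 0 < t ->
  is_derive t 1 (sinhprim y) (ln (t ^+ 2 + y ^+ 2) - 2 * ln t).
Proof.
move=> y0 t0.
have ty0 : 0 < t ^+ 2 + y ^+ 2 by rewrite addr_gt0 ?exprn_gt0.
have d1 : is_derive t 1 (fun t => t ^+ 2 + y ^+ 2) (2 * t).
  by apply: is_derive_eq; rewrite /GRing.scale /=; ring.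
have d2 := @is_derive1_comp _ (@ln R) (fun t => t ^+ 2 + y ^+ 2) t _ _ (is_derive1_ln ty0) d1.
have d3 := is_derive1_ln t0.
have d4 : is_derive t 1 (fun t => t / y) y^-1.
  by apply: is_derive_eq; rewrite /GRing.scale /=; ring.
have d5 := @is_derive1_comp _ atan (fun t => t / y) t _ _ (is_derive1_atan (t / y)) d4.
have -> : sinhprim y = (fun t : R => t) *
    ((@ln R \o (fun t => t ^+ 2 + y ^+ 2)) - (2 *: @ln R)) +
    (2 * y) *: (atan \o (fun t => t / y)).
  by apply/funext => s.
apply: (is_derive_eq (is_deriveD (is_deriveM (is_derive_id t 1)
  (is_deriveB d2 (is_deriveZ 2 d3))) (is_deriveZ (2 * y) d5))).
rewrite /GRing.scale /= !fctE /GRing.scale /=.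
rewrite -[2 *: ln t]/(2 * ln t); field.
by rewrite !gt_eqF//= addrC.
Qed.

Lemma MVT_pos (f f' : R -> R) a b : a < b ->
  (forall t, a <= t -> is_derive t 1 f (f' t)) ->
  exists2 t, a < t < b & f b - f a = f' t * (b - a).
Proof.
move=> ab df.
have [t tab E] : exists2 t, t \in `]a, b[ & f b - f a = f' t * (b - a).
  apply: MVT => // [t|]; first by rewrite in_itv/= => /andP[/ltW at_ _]; exact: df.
  apply: derivable_within_continuous => t; rewrite in_itv/= => /andP[at_ _].
  by have [] := df _ at_.
by exists t => //; rewrite in_itv in tab.
Qed.

Lemma atan_le t : 0 <= t -> atan t <= t.
Proof.
rewrite le_eqVlt => /predU1P[<-|t0]; first by rewrite atan0.
have [s /andP[s0 _]] := MVT_pos t0 (fun s _ => is_derive1_atan s).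
rewrite atan0 !subr0 => ->; rewrite ger_pMl// invf_le1 ?lerDl ?sqr_ge0//.
by rewrite ltr_pwDl// sqr_ge0.
Qed.

Lemma ln_ratio y t : 0 < t ->
  ln (t ^+ 2 + y ^+ 2) - 2 * ln t = ln (1 + y ^+ 2 / t ^+ 2).
Proof.
move=> t0; have ty0 : 0 < t ^+ 2 + y ^+ 2 by rewrite ltr_pwDl ?sqr_ge0 ?exprn_gt0.
rewrite mulr_natl -lnXn// -ln_div ?posrE ?exprn_gt0//.
by rewrite mulrDl divff// expf_neq0// gt_eqF.
Qed.

(** The mean value theorem replaces the integral over [[t, t + 1]]. The derivative decreases, so for
    a positive integer [t] this value lies between the logarithms of two consecutive factors of
    [sinhprod]. *)
Lemma sinhprim_incr y t : 0 < y -> 0 < t ->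
  exists2 s, t < s < t + 1 & sinhprim y (t + 1) - sinhprim y t =
                             ln (1 + y ^+ 2 / s ^+ 2).
Proof.
move=> y0 t0; have tt : t < t + 1 by rewrite ltrDl.
have [|s /andP[ts st]] := MVT_pos (f := sinhprim y)
    (f' := fun t => ln (t ^+ 2 + y ^+ 2) - 2 * ln t) tt.
  by move=> s /(lt_le_trans t0) s0; exact: is_derive_sinhprim.
rewrite [t + 1 - t]addrAC subrr add0r mulr1 ln_ratio ?(lt_trans t0)// => ->.
by exists s => //; rewrite ts.
Qed.

Lemma ln_ratio_le y s t : 0 < s -> s <= t ->
  ln (1 + y ^+ 2 / t ^+ 2) <= ln (1 + y ^+ 2 / s ^+ 2).
Proof.
move=> s0 st; have t0 := lt_le_trans s0 st.
have h (u : R) : 0 < 1 + y ^+ 2 / u ^+ 2.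
  by rewrite ltr_pwDl// divr_ge0 ?sqr_ge0.
rewrite ler_ln ?posrE// lerD2l ler_wpM2l ?sqr_ge0//.
rewrite lef_pV2 ?posrE ?exprn_gt0// lerXn2r ?nnegrE ?(ltW s0) ?(ltW t0)//.
Qed.

Lemma sinhprodS n y :
  sinhprod n.+1 y = sinhprod n y * (1 + y ^+ 2 / n.+1%:R ^+ 2).
Proof. by rewrite /sinhprod big_ord_recr. Qed.

(* The logarithm of the product is compared with the integral of
   t |-> ln (1 + y^2 / t^2), of which sinhprim y is a primitive. *)
Lemma sinhprod_le n y : 0 < y ->
  sinhprod n.+1 y <= expR (y ^+ 2 / n.+1%:R + pi * y).
Proof.
move=> y0; have h (u : R) : 0 < 1 + y ^+ 2 / u ^+ 2.
  by rewrite ltr_pwDl// divr_ge0 ?sqr_ge0.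
have atan_ge0 (t : R) : 0 <= t -> 0 <= atan t.
  by move=> t0; rewrite -atan0 le_atan.
apply: (@le_trans _ _ (expR (sinhprim y n.+1%:R))).
  elim: n => [|n IH].
    rewrite /sinhprod big_ord_recl big_ord0 mulr1 -ler_ln ?posrE ?expR_gt0// expRK.
    rewrite /sinhprim ln1 mulr0 subr0 mul1r expr1n divr1 lerDl.
    by rewrite mulr_ge0 ?atan_ge0 ?divr_ge0 ?ltW// mulr_gt0.
  rewrite sinhprodS -natr1.
  have [s /andP[ns sn] E] := sinhprim_incr y0 (ltr0Sn R n).
  rewrite -[sinhprim _ _](subrK (sinhprim y n.+1%:R)) E [_ + sinhprim _ _]addrC expRD.
  apply: ler_pM => //; [exact/ltW/sinhprod_gt0|exact/ltW|].
  have s0 : 0 < s := lt_trans (ltr0Sn R n) ns.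
  by rewrite lnK ?posrE// -ler_ln ?posrE// ln_ratio_le// ltW.
(* [ln (1 + u) <= u] bounds the first term of [sinhprim], and [atan < pi / 2] the second. *)
rewrite ler_expR; apply: lerD.
  rewrite ln_ratio//.
  apply: (@le_trans _ _ (n.+1%:R * (y ^+ 2 / n.+1%:R ^+ 2))).
    rewrite ler_wpM2l// le_ln1Dx// (lt_le_trans _ (_ : 0 <= _))//.
    by rewrite divr_ge0 ?sqr_ge0.
  rewrite le_eqVlt; apply/orP; left; apply/eqP.
  have : n.+1%:R != 0 :> R by [].
  by move: (n.+1%:R : R) => z z0; field.
rewrite (_ : pi * y = 2 * y * (pi / 2)); last by field.
by rewrite ler_wpM2l ?ltW ?mulr_gt0 ?atan_ltpi2.
Qed.

(** The factor [(1 + y ^+ 2) * expR 2] is a bound for [expR (sinhprim y 1)], the value at the start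
    of the comparison: there [2 * y * atan (1 / y) <= 2] because [atan t <= t]. *)
Lemma sinhprod_ge n y : 0 < y ->
  expR (2 * y * atan (n.+1%:R / y)) <= (1 + y ^+ 2) * expR 2 * sinhprod n y.
Proof.
move=> y0; have h (u : R) : 0 < 1 + y ^+ 2 / u ^+ 2.
  by rewrite ltr_pwDl// divr_ge0 ?sqr_ge0.
apply: (@le_trans _ _ (expR (sinhprim y n.+1%:R))).
  rewrite ler_expR lerDr mulr_ge0// ln_ratio// ln_ge0// lerDl.
  by rewrite divr_ge0 ?sqr_ge0.
have : expR (sinhprim y n.+1%:R) <= expR (sinhprim y 1) * sinhprod n y.
  elim: n => [|n IH]; first by rewrite /sinhprod big_ord0 mulr1.
  rewrite sinhprodS -(natr1 n.+1) mulrA.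
  have [s /andP[ns sn] E] := sinhprim_incr y0 (ltr0Sn R n).
  rewrite -[sinhprim _ (_ + 1)](subrK (sinhprim y n.+1%:R)) E [_ + sinhprim _ _]addrC expRD.
  apply: ler_pM => //; rewrite ?expR_ge0//.
  have s0 : 0 < s := lt_trans (ltr0Sn R n) ns.
  by rewrite lnK ?posrE// -ler_ln ?posrE// ln_ratio_le// ltW.
move/le_trans; apply; rewrite ler_wpM2r ?(ltW (sinhprod_gt0 _ _))//.
rewrite /sinhprim ln1 mulr0 subr0 mul1r expr1n expRD lnK ?posrE; last first.
  by have := h 1; rewrite expr1n divr1.
rewrite ler_wpM2l ?addr_ge0 ?sqr_ge0// ler_expR.
rewrite -{2}(mulr1 2) -mulrA ler_wpM2l// mulrC -ler_pdivlMr//.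
by rewrite atan_le// divr_ge0 ?ltW.
Qed.

End sinh_product.

(** * Bounds for Gamma on vertical lines *)

Section normc.
Context {R : realType}.
Implicit Types z w : R[i].

Lemma sqr_normcE z : normc z ^+ 2 = complex.Re z ^+ 2 + complex.Im z ^+ 2.
Proof. by case: z => a b /=; rewrite sqr_sqrtr// addr_ge0 ?sqr_ge0. Qed.

Lemma normc_ge0 z : 0 <= normc z.
Proof. by case: z => a b /=; exact: sqrtr_ge0. Qed.

Lemma normc_real (x : R) : normc x%:C = `|x|.
Proof. by rewrite /= expr0n addr0 sqrtr_sqr. Qed.

Lemma normr_normc z : `|z| = (normc z)%:C.
Proof. by []. Qed.

Lemma normc_prod I (s : seq I) (P : pred I) (f : I -> R[i]) :
  normc (\prod_(i <- s | P i) f i) = \prod_(i <- s | P i) normc (f i).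
Proof.
by apply: (big_morph _ (@ComplexField.Normc.normcM R)); exact: ComplexField.Normc.normc1.
Qed.

Lemma normc_Cexp z : normc (Cexp z) = expR (complex.Re z).
Proof.
rewrite /Cexp ComplexField.Normc.normcM normc_real ger0_norm ?expR_ge0//=.
by rewrite cos2Dsin2 sqrtr1 mulr1.
Qed.

Lemma normrRe_le_normc z : `|complex.Re z| <= normc z.
Proof. by rewrite -lecR; exact: normc_ge_Re. Qed.

Lemma normrIm_le_normc z : `|complex.Im z| <= normc z.
Proof.
rewrite -ler_sqr ?nnegrE ?normc_ge0// sqr_normcE real_normK ?num_real//.
by rewrite lerDr sqr_ge0.
Qed.

End normc.

Section Gamma_bounds.
Context {R : realType}.
Implicit Types (z : R[i]) (y b e : R) (n : nat).

Definition gauss_seq z n : R[i] :=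
  n`!%:R * Cexp (z * (ln n%:R)%:C) / \prod_(j < n.+1) (z + j%:R).

Lemma cvg_sqr_normc_gauss z : Gamma z != 0 ->
  (fun n => normc (gauss_seq z n) ^+ 2) @ \oo --> normc (Gamma z) ^+ 2.
Proof.
move=> G0.
have /cvg_complexP[cr ci] : (gauss_seq z : nat -> (R[i] : numFieldType)) @ \oo -->
    (Gamma z : (R[i] : numFieldType)).
  have [//|dv] := pselect (cvgn (gauss_seq z : nat -> (R[i] : numFieldType))).
  have := dvgP dv; rewrite -[LHS]/(Gamma z) => Gz.
  by move: G0; rewrite Gz eqxx.
rewrite sqr_normcE.
under eq_fun do rewrite sqr_normcE.
by apply: cvgD; rewrite expr2; under eq_fun do rewrite expr2; apply: cvgM.
Qed.

(* Where Gauss' sequence diverges, lim takes the default value 0, for which both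
   upper bounds hold trivially; so the convergence of the sequence is not needed. *)
Lemma sqr_normc_Gamma_le z b : 0 <= b ->
  (\forall n \near \oo, normc (gauss_seq z n) ^+ 2 <= b) ->
  normc (Gamma z) ^+ 2 <= b.
Proof.
move=> b0 H; have [->|G0] := eqVneq (Gamma z) 0.
  by rewrite ComplexField.Normc.normc0 expr0n.
exact: cvgr_to_le (cvg_sqr_normc_gauss G0) H.
Qed.

Lemma normc_GammaV2_le z b : 0 <= b ->
  (\forall n \near \oo, normc (gauss_seq z n) ^- 2 <= b) ->
  normc (Gamma z) ^- 2 <= b.
Proof.
move=> b0 H; have [->|G0] := eqVneq (Gamma z) 0.
  by rewrite ComplexField.Normc.normc0 expr0n invr0.
have nG0 : normc (Gamma z) ^+ 2 != 0.
  by rewrite expf_neq0//; apply: contra_neq G0; exact: ComplexField.Normc.eq0_normc.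
exact: cvgr_to_le (cvgV nG0 (cvg_sqr_normc_gauss G0)) H.
Qed.

Lemma sqr_normc_gauss (a y : R) n : normc (gauss_seq (a +i* y) n) ^+ 2 =
  n`!%:R ^+ 2 * expR (a * ln n%:R) ^+ 2 / \prod_(j < n.+1) ((a + j%:R) ^+ 2 + y ^+ 2).
Proof.
rewrite /gauss_seq 2!ComplexField.Normc.normcM ComplexField.Normc.normcV.
rewrite normc_Cexp normc_prod !exprMn exprVn; congr (_ * _ / _).
- by rewrite -(rmorph_nat (real_complex R)) normc_real ger0_norm.
- by rewrite /= mulr0 subr0.
- rewrite -prodrXl; apply: eq_bigr => j _.
  by rewrite sqr_normcE -(rmorph_nat (real_complex R)) /= addr0.
Qed.

Lemma prod_succ_sqr n y :
  \prod_(j < n) (j.+1%:R ^+ 2 + y ^+ 2) = n`!%:R ^+ 2 * sinhprod n y.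
Proof.
elim: n => [|n IH]; first by rewrite /sinhprod !big_ord0 mulr1 expr1n.
rewrite big_ord_recr /= IH sinhprodS factS natrM.
have : n.+1%:R != 0 :> R by [].
by move: (n.+1%:R : R) => x x0; field.
Qed.

Lemma sqr_div_le1 y : \forall n \near \oo, y ^+ 2 / n.+1%:R <= 1.
Proof.
near=> n; rewrite ler_pdivrMr// mul1r -natr1.
apply: (@le_trans _ _ n%:R); last by rewrite lerDl.
by near: n; exact: nbhs_infty_ger.
Unshelve. all: by end_near. Qed.

Lemma sinhprod_near_le y :
  \forall n \near \oo, sinhprod n y <= expR 1 * expR (pi * `|y|).
Proof.
have [->|y0] := eqVneq y 0.
  apply: nearW => n; rewrite normr0 mulr0 expR0 mulr1 /sinhprod big1; last first.
    by move=> j _; rewrite expr0n mul0r addr0.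
  by rewrite -expR0 ler_expR.
have {}y0 : 0 < `|y| by rewrite normr_gt0.
near=> n; have n0 : (0 < n)%N by near: n; exists 1.
rewrite -(sinhprod_norm n) -(prednK n0).
apply: (le_trans (sinhprod_le _ y0)); rewrite -expRD ler_expR lerD2r.
rewrite prednK// real_normK ?num_real//; near: n.
have := sqr_div_le1 y; rewrite !near_simpl => -[N _ H].
exists N.+1 => // n /= Nn.
by have := H n.-1; rewrite /= prednK//; [apply; rewrite -ltnS prednK|]; exact: leq_trans Nn.
Unshelve. all: by end_near. Qed.

(** Once the arctangent is within [1 / (2 |y|)] of [pi / 2], the exponent in [sinhprod_ge] falls
    short of [pi |y|] by at most 1, which turns [expR 2] into [expR 3]. *)
Lemma sinhprod_near_ge y : \forall n \near \oo,
  expR (pi * `|y|) <= (1 + y ^+ 2) * expR 3 * sinhprod n y.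
Proof.
have [->|y0] := eqVneq y 0.
  apply: nearW => n; rewrite normr0 mulr0 expR0 /sinhprod big1; last first.
    by move=> j _; rewrite expr0n mul0r addr0.
  by rewrite expr0n addr0 mul1r mulr1 -expR0 ler_expR.
have {}y0 : 0 < `|y| by rewrite normr_gt0.
have ca : (fun n : nat => atan (n.+1%:R / `|y|)) @ \oo --> (pi / 2 : R).
  apply: (@cvg_comp _ _ _ (fun n : nat => n.+1%:R / `|y|) atan _ +oo); last exact: cvgy_atan.
  apply/cvgryPge => A; near=> n.
  rewrite ler_pdivlMr//.
  apply: (@le_trans _ _ n%:R); last by rewrite ler_nat.
  by near: n; exact: nbhs_infty_ger.
near=> n.
have : pi / 2 - (2 * `|y|)^-1 <= atan (n.+1%:R / `|y|).
  near: n; move/cvgrPdist_le : ca => /(_ (2 * `|y|)^-1).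
  rewrite invr_gt0 mulr_gt0// => /(_ isT).
  by apply: filterS => n; rewrite ler_norml => /andP[_]; rewrite lerBlDr addrC -lerBlDr.
move=> h.
have := sinhprod_ge n y0; rewrite sinhprod_norm real_normK ?num_real// => hn.
rewrite (_ : 3 = 1 + 2)// expRD.
rewrite [leRHS](_ : _ = expR 1 * ((1 + y ^+ 2) * expR 2 * sinhprod n y)); last by ring.
rewrite -ler_pdivrMl ?expR_gt0// -expRN -expRD.
apply: le_trans hn; rewrite ler_expR.
apply: (@le_trans _ _ (2 * `|y| * (pi / 2 - (2 * `|y|)^-1))).
  rewrite mulrBr mulfV ?gt_eqF ?mulr_gt0// addrC lerD2r.
  by rewrite le_eqVlt; apply/orP; left; apply/eqP; field.
by rewrite ler_wpM2l// mulr_ge0.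
Unshelve. all: by end_near. Qed.

(** From [1 + u^2 / 2 <= expR u] with [u = e |y|]. It absorbs polynomial factors into a small
    exponential loss, and later trades exponential decay for decay like [1 / (1 + y^2)]. *)
Lemma poly_le_expR e : 0 < e ->
  exists2 C : R, 0 < C & forall y, 1 + y ^+ 2 <= C * expR (e * `|y|).
Proof.
move=> e0; exists (1 + 2 / e ^+ 2) => [|y].
  by rewrite ltr_pwDl// divr_ge0 ?sqr_ge0.
have ey : 0 <= e * `|y| by rewrite mulr_ge0// ltW.
have h := expR_ge1Dxn 1 ey.
rewrite mulrDl mul1r lerD//.
  by rewrite -expR0 ler_expR.
apply: (@le_trans _ _ (2 / e ^+ 2 * ((e * `|y|) ^+ 2 / 2))).
  rewrite exprMn real_normK ?num_real// le_eqVlt; apply/orP; left; apply/eqP.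
  by move: `|y| => u; field; rewrite gt_eqF.
rewrite ler_wpM2l ?divr_ge0 ?sqr_ge0//; apply: le_trans h.
by rewrite (_ : 2%N`! = 2%N)// lerDr.
Qed.

(** The exact value is [y sinh (pi y) / pi]. In Gauss' denominator the index 0 gives the factor
    [y^2], paid for by [e]; the other indices give [sinhprod] once the factorials cancel. *)
Lemma normc_GammaV2_0_le e : 0 < e -> exists2 C : R, 0 < C &
  forall y, normc (Gamma (0 +i* y)) ^- 2 <= C * expR ((pi + e) * `|y|).
Proof.
move=> e0; have [C C0 HC] := poly_le_expR e0.
exists (C * expR 1) => [|y]; first by rewrite mulr_gt0 ?expR_gt0.
apply: normc_GammaV2_le; first by rewrite mulr_ge0 ?expR_ge0// ltW// mulr_gt0 ?expR_gt0.
near=> n.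
rewrite sqr_normc_gauss mul0r expR0 expr1n mulr1 invfM invrK.
rewrite big_ord_recl /= addr0 expr0n add0r.
under eq_bigr do rewrite add0r.
rewrite prod_succ_sqr mulrCA mulKf; last first.
  by rewrite expf_neq0// pnatr_eq0 -lt0n fact_gt0.
apply: (@le_trans _ _ ((1 + y ^+ 2) * (expR 1 * expR (pi * `|y|)))).
  apply: ler_pM; rewrite ?sqr_ge0 ?lerDr ?(ltW (sinhprod_gt0 _ _))//.
  by near: n; exact: sinhprod_near_le.
apply: (@le_trans _ _ (C * expR (e * `|y|) * (expR 1 * expR (pi * `|y|)))).
  by rewrite ler_wpM2r// mulr_ge0 ?expR_ge0.
by rewrite (mulrDl pi e) expRD le_eqVlt; apply/orP; left; apply/eqP; ring.
Unshelve. all: by end_near. Qed.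

Lemma normc_GammaV2_1_le e : 0 < e -> exists2 C : R, 0 < C &
  forall y, normc (Gamma (1 +i* y)) ^- 2 <= C * expR ((pi + e) * `|y|).
Proof.
move=> e0.
exists (4 * expR 1) => [|y]; first by rewrite mulr_gt0 ?expR_gt0.
apply: normc_GammaV2_le; first by rewrite mulr_ge0 ?expR_ge0// ltW// mulr_gt0 ?expR_gt0.
near=> n; have n0 : (0 < n)%N by near: n; exists 1.
rewrite sqr_normc_gauss mul1r lnK ?posrE ?ltr0n// invfM invrK.
under eq_bigr do rewrite nat1r.
rewrite prod_succ_sqr factS natrM.
have nf : n`!%:R != 0 :> R by rewrite pnatr_eq0 -lt0n fact_gt0.
(* On this line the denominator starts at 1 and produces [(n + 1)!] against [n! * n] in the
   numerator; [(n + 1) / n <= 2] accounts for the constant 4. *)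
rewrite (_ : _ * _ = (n.+1%:R / n%:R) ^+ 2 * sinhprod n.+1 y); last first.
  have : n%:R != 0 :> R by rewrite pnatr_eq0 -lt0n.
  by move: nf; move: (n`!%:R : R) (n%:R : R) => u v u0 v0; field; rewrite ?u0 ?v0.
apply: (@le_trans _ _ (4 * (expR 1 * expR (pi * `|y|)))); last first.
  rewrite -mulrA ler_wpM2l// ler_wpM2l ?expR_ge0// ler_expR (mulrDl pi e) lerDl.
  by rewrite mulr_ge0// ltW.
apply: ler_pM; rewrite ?sqr_ge0 ?(ltW (sinhprod_gt0 _ _))//.
  rewrite (_ : 4 = 2 ^+ 2); last by ring.
  rewrite lerXn2r ?nnegrE ?divr_ge0// ler_pdivrMr ?ltr0n// -natrM ler_nat.
  by rewrite mul2n -addnn -addn1 leq_add2l.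
near: n; have [N _ H] := sinhprod_near_le y.
by exists N => // n /= Nn; apply: H => /=; exact: leqW.
Unshelve. all: by end_near. Qed.

(** A Wallis-type bound, with equality at [n = 0]. With [k = n + 1], the induction step multiplies
    the left side by [k (k + 1)] and the right side by [(k + 1/2)^2 = k (k + 1) + 1/4]. *)
Lemma prod_half_ge n :
  n.+1%:R * n`!%:R ^+ 2 <= 4 * \prod_(j < n.+1) (2^-1 + j%:R) ^+ 2 :> R.
Proof.
elim: n => [|n IH].
  rewrite big_ord_recl big_ord0 addr0 expr1n mulr1 mulr1 exprVn.
  by rewrite (_ : 4 = 2 ^+ 2) ?divff ?expf_neq0//; ring.
rewrite big_ord_recr /= factS mulrA.
have -> : n.+2%:R * (n.+1 * n`!)%:R ^+ 2 = (n.+1%:R * n`!%:R ^+ 2) * (n.+1%:R * n.+2%:R) :> R.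
  by rewrite natrM; ring.
apply: ler_pM => //; rewrite ?mulr_ge0 ?sqr_ge0//.
rewrite -[n.+2%:R]natr1 (_ : (2^-1 + n.+1%:R) ^+ 2 = n.+1%:R * (n.+1%:R + 1) + 4^-1).
  by rewrite lerDl.
by field.
Qed.

Lemma normc_Gamma_half_le e : 0 < e -> exists2 C : R, 0 < C &
  forall y, normc (Gamma (2^-1 +i* y)) <= C * expR (- (pi / 2 - e) * `|y|).
Proof.
(* Squared moduli are compared, so the loss doubles. In the witness, [1 + K] is taken because its
   square dominates [K]. *)
move=> e0; have e20 : 0 < e * 2 by rewrite mulr_gt0.
have [C C0 HC] := poly_le_expR e20.
exists (1 + C * (4 * expR 3)) => [|y].
  by rewrite ltr_pwDl// ltW// !mulr_gt0 ?expR_gt0.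
set K := C * (4 * expR 3); have K0 : 0 < K by rewrite !mulr_gt0 ?expR_gt0.
rewrite -ler_sqr ?nnegrE ?normc_ge0 ?mulr_ge0 ?expR_ge0 ?addr_ge0 ?(ltW K0)//.
apply: sqr_normc_Gamma_le; first exact: sqr_ge0.
near=> n; have n0 : (0 < n)%N by near: n; exists 1.
have hE : expR (2^-1 * ln n%:R) ^+ 2 = n%:R :> R.
  by rewrite -expRM_natr (mulrC _ (ln _)) divfK// lnK ?posrE ?ltr0n.
rewrite sqr_normc_gauss hE.
apply: (@le_trans _ _ (K * expR (- (pi / 2 - e) * `|y|) ^+ 2)); last first.
  rewrite exprMn ler_wpM2r ?sqr_ge0//.
  apply: (@le_trans _ _ (1 + K)); first by rewrite lerDr.
  by rewrite expr2 ler_peMl ?lerDl ?addr_ge0 ?ltW.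
rewrite ler_pdivrMr; last first.
  apply: prodr_gt0 => j _.
  have j0 : 0 < 2^-1 + j%:R :> R by rewrite ltr_pwDl.
  by rewrite ltr_pwDl ?sqr_ge0// exprn_gt0.
(* Since [1/2 + j <= j + 1], the factor [(1/2 + j)^2 + y^2] is at least
   [(1/2 + j)^2 (1 + y^2 / (j + 1)^2)]: the denominator dominates a Wallis product times
   [sinhprod]. *)
apply: (@le_trans _ _ (K * expR (- (pi / 2 - e) * `|y|) ^+ 2 *
  (\prod_(j < n.+1) (2^-1 + j%:R) ^+ 2 * sinhprod n.+1 y))); last first.

  apply: ler_wpM2l; first by apply: mulr_ge0; [exact: ltW|exact: sqr_ge0].
  rewrite /sinhprod -big_split /= ler_prod// => j _.
  have j0 : 0 < 2^-1 + j%:R :> R by rewrite ltr_pwDl.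
  have jj : 2^-1 + j%:R <= j.+1%:R :> R by rewrite -(natr1 j) addrC lerD2l; lra.
  rewrite mulr_ge0 ?sqr_ge0 ?addr_ge0 ?divr_ge0 ?sqr_ge0//= mulrDr mulr1 lerD2l.
  rewrite mulrCA ler_piMr ?sqr_ge0// ler_pdivrMr ?exprn_gt0// mul1r.
  by rewrite lerXn2r ?nnegrE// ltW.
have hs : expR (pi * `|y|) <= (1 + y ^+ 2) * expR 3 * sinhprod n.+1 y.
  near: n; have [N _ H] := sinhprod_near_ge y.
  by exists N => // n /= Nn; apply: H => /=; exact: leqW.
have hn : n`!%:R ^+ 2 * n%:R <= 4 * \prod_(j < n.+1) (2^-1 + j%:R) ^+ 2 :> R.
  apply: le_trans (prod_half_ge n); rewrite mulrC ler_wpM2r ?sqr_ge0//.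
  by rewrite ler_nat.
apply: (le_trans hn); rewrite mulrCA (mulrC _ (\prod_(j < _) _)) ler_wpM2l//.
  by apply: prodr_ge0 => j _; exact: sqr_ge0.
have -> : expR (- (pi / 2 - e) * `|y|) ^+ 2 = expR (e * 2 * `|y|) / expR (pi * `|y|).
  by rewrite -expRM_natr -expRN -expRD; congr expR; field.
rewrite /K.
have := le_trans hs (ler_wpM2r (ltW (sinhprod_gt0 n.+1 y))
   (ler_wpM2r (expR_ge0 3) (HC y))).
move=> H.
rewrite -[leLHS]mulr1 [leRHS](_ : _ = 4 * ((C * expR (e * 2 * `|y|) * expR 3 *
  sinhprod n.+1 y) / expR (pi * `|y|))); last by ring.
by rewrite ler_pM2l// ler_pdivlMr ?expR_gt0// mul1r.
Unshelve. all: by end_near. Qed.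

End Gamma_bounds.

(** * The kernel min *)

Section min_kernel.
Context {R : realFieldType}.
Implicit Types (S T : seq R) (l : seq (R * R)).

Definition sum_min S T : R := \sum_(p <- S) \sum_(q <- T) Num.min p q.
Definition sum_max S T : R := \sum_(p <- S) \sum_(q <- T) Num.max p q.
Definition seqmax S : R := \big[Num.max/0]_(x <- S) x.

Let quad l : R := \sum_(p <- l) \sum_(q <- l) p.1 * q.1 * Num.min p.2 q.2.

Lemma exists_min_snd l : l != [::] ->
  exists2 x, x \in l & forall y, y \in l -> x.2 <= y.2.
Proof.
elim: l => // x l IH _; have [->|/IH[z zl Hz]] := eqVneq l [::].
  by exists x; rewrite ?mem_head// => y; rewrite inE => /eqP ->.
have [xz|zx] := leP x.2 z.2.
  exists x; rewrite ?mem_head// => y; rewrite inE => /predU1P[->//|/Hz].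
  exact: le_trans.
exists z; first by rewrite inE zl orbT.
by move=> y; rewrite inE => /predU1P[->|/Hz//]; exact: ltW.
Qed.

(** Induction on the number of points. Shifting all abscissas down by the smallest one, [x.2],
    lowers every entry of the kernel by [x.2], which takes out [x.2] times the square of the total
    weight; the entries of [x] itself become 0 and that point drops out. *)
Lemma min_kernel_ge0 l : (forall x, x \in l -> 0 <= x.2) -> 0 <= quad l.
Proof.
elim: {l}(size l) {-2}l (leqnn (size l)) => [|n IH] l.
  by rewrite leqn0 size_eq0 => /eqP-> _; rewrite /quad big_nil.
move=> sl l0; have [->|/exists_min_snd[x xl xmin]] := eqVneq l [::].
  by rewrite /quad big_nil.
have pl := perm_to_rem xl; set l' := rem x l in pl.
have l'l y : y \in l' -> y \in l.
  by move=> yl'; rewrite (perm_mem pl) inE yl' orbT.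
pose l2 := [seq (y.1, y.2 - x.2) | y <- l'].
have -> : quad l = x.2 * (x.1 + \sum_(y <- l') y.1) ^+ 2 + quad l2.
  have -> : quad l = quad (x :: l').
    rewrite /quad (perm_big _ pl); apply: eq_bigr => y _.
    by rewrite (perm_big _ pl).
  have -> : quad l2 = quad l' - x.2 * (\sum_(y <- l') y.1) ^+ 2.
    rewrite /quad big_map expr2 mulr_suml mulr_sumr -sumrB.
    apply: eq_bigr => p _; rewrite big_map !mulr_sumr -sumrB.
    apply: eq_bigr => q _ /=; rewrite -addr_minl; ring.
  rewrite /quad !big_cons minxx.
  have -> : \sum_(q <- l') x.1 * q.1 * Num.min x.2 q.2 =
            x.1 * x.2 * \sum_(q <- l') q.1.
    rewrite mulr_sumr big_seq_cond [RHS]big_seq_cond; apply: eq_bigr => q.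
    by rewrite andbT => /l'l/xmin xq; rewrite min_l//; ring.
  have -> : \sum_(p <- l') \sum_(q <- x :: l') p.1 * q.1 * Num.min p.2 q.2 =
      x.1 * x.2 * (\sum_(q <- l') q.1) +
      \sum_(p <- l') \sum_(q <- l') p.1 * q.1 * Num.min p.2 q.2.
    under eq_bigr do rewrite big_cons.
    rewrite big_split /=; congr +%R.
    rewrite mulr_sumr big_seq_cond [RHS]big_seq_cond; apply: eq_bigr => q.
    by rewrite andbT => /l'l/xmin xq; rewrite min_r//; ring.
  by ring.
apply: addr_ge0; first by rewrite mulr_ge0 ?sqr_ge0 ?l0.
apply: IH => [|_ /mapP[y /l'l/xmin xy ->] /=]; last by rewrite subr_ge0.
by rewrite size_map -ltnS (leq_trans _ sl)// (perm_size pl).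
Qed.

(** For nonnegative entries [min p q] is the integral over [t >= 0] of the product of the indicators
    of [t < p] and [t < q], so this is the squared L2 distance between the functions counting the
    entries of [S] and of [T] above [t]. Between the two maxima one count is 0 and the other a
    positive integer, whence the lower bound by the distance of the maxima. *)
Definition min_dist S T : R := sum_min S S - 2 * sum_min S T + sum_min T T.

Lemma sum_minC S T : sum_min S T = sum_min T S.
Proof.
rewrite /sum_min exchange_big; apply: eq_bigr => p _; apply: eq_bigr => q _.
exact: minC.
Qed.

Lemma min_distC S T : min_dist S T = min_dist T S.
Proof. by rewrite /min_dist (sum_minC S T); ring. Qed.

Lemma min_dist_ge0 S T : (forall x, x \in S -> 0 <= x) ->
  (forall x, x \in T -> 0 <= x) -> 0 <= min_dist S T.
Proof.
move=> S0 T0.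
have := @min_kernel_ge0 ([seq (1, x) | x <- S] ++ [seq (-1, x) | x <- T]).
have -> : quad ([seq (1, x) | x <- S] ++ [seq (-1, x) | x <- T]) = min_dist S T.
  rewrite /quad big_cat /= !big_map /=.
  under eq_bigr do rewrite big_cat /= !big_map /=.
  under [X in _ + X]eq_bigr do rewrite big_cat /= !big_map /=.
  rewrite !big_split /=.
  have E U V (a b : R) : \sum_(p <- U) \sum_(q <- V) a * b * Num.min p q =
      a * b * sum_min U V.
    by rewrite mulr_sumr; apply: eq_bigr => p _; rewrite mulr_sumr.
  by rewrite !E /min_dist (sum_minC T S); ring.
apply => x; rewrite mem_cat => /orP[] /mapP[y yS ->] /=; [exact: S0|exact: T0].
Qed.

Lemma sum_min_ge0 S T : (forall x, x \in S -> 0 <= x) ->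
  (forall x, x \in T -> 0 <= x) -> 0 <= sum_min S T.
Proof.
move=> S0 T0; rewrite /sum_min big_seq; apply: sumr_ge0 => p /S0 p0.
by rewrite big_seq; apply: sumr_ge0 => q /T0 q0; rewrite le_min p0.
Qed.

Lemma sum_min_diag_ge S x : (forall x, x \in S -> 0 <= x) -> x \in S ->
  x <= sum_min S S.
Proof.
move=> S0 xS; rewrite /sum_min (big_rem x)//= (big_rem x)//= minxx -addrA lerDl.
apply: addr_ge0.
  rewrite big_seq; apply: sumr_ge0 => q /mem_rem/S0 q0.
  by rewrite le_min q0 S0.
rewrite big_seq; apply: sumr_ge0 => q /mem_rem/S0 q0.
by rewrite big_seq; apply: sumr_ge0 => p /S0 p0; rewrite le_min q0.
Qed.

Lemma seqmax_ge0 S : 0 <= seqmax S.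
Proof. exact: bigmax_ge_id. Qed.

Lemma le_seqmax S x : x \in S -> x <= seqmax S.
Proof. by move=> xS; apply: le_bigmax_seq xS _. Qed.

Lemma seqmax_le S b : 0 <= b -> (forall x, x \in S -> x <= b) -> seqmax S <= b.
Proof.
move=> b0 Sb; rewrite /seqmax big_seq_cond; apply: bigmax_le => // x /andP[xS _].
exact: Sb.
Qed.

(* Truncation at t := seqmax T splits the kernel min into the kernels of the
   parts below and above t, and T only sees the part below. *)
Lemma seqmaxB_le_min_dist S T : (forall x, x \in S -> 0 <= x) ->
  (forall x, x \in T -> 0 <= x) -> seqmax S - seqmax T <= min_dist S T.
Proof.
move=> S0 T0; set t := seqmax T; have t0 : 0 <= t by exact: seqmax_ge0.
pose lo (x : R) := Num.min x t; pose hi (x : R) := Num.max (x - t) 0.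
have loP x : (x <= t -> lo x = x /\ hi x = 0) /\ (t < x -> lo x = t /\ hi x = x - t).
  rewrite /lo /hi; split => xt; first by rewrite min_l// max_r// subr_le0.
  by rewrite min_r ?ltW// max_l// subr_ge0 ltW.
have minE x y : Num.min x y = Num.min (lo x) (lo y) + Num.min (hi x) (hi y).
  have [hx hx'] := loP x; have [hy hy'] := loP y.
  have [xt|xt] := leP x t; have [yt|yt] := leP y t.
  - by rewrite (hx xt).1 (hx xt).2 (hy yt).1 (hy yt).2 minxx addr0.
  - rewrite (hx xt).1 (hx xt).2 (hy' yt).1 (hy' yt).2.
    by rewrite [Num.min x y]min_l 1?[Num.min x t]min_l 1?[Num.min 0 _]min_l; lra.
  - rewrite (hx' xt).1 (hx' xt).2 (hy yt).1 (hy yt).2.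
    by rewrite [Num.min x y]min_r 1?[Num.min t y]min_r 1?[Num.min _ 0]min_r; lra.
  - rewrite (hx' xt).1 (hx' xt).2 (hy' yt).1 (hy' yt).2 minxx -addr_minl.
    by rewrite addrC subrK.
have sum_minE U V : sum_min U V =
    sum_min (map lo U) (map lo V) + sum_min (map hi U) (map hi V).
  rewrite /sum_min !big_map -big_split; apply: eq_bigr => p _.
  by rewrite !big_map -big_split; apply: eq_bigr => q _; exact: minE.
have lo0 U : (forall x, x \in U -> 0 <= x) -> forall x, x \in map lo U -> 0 <= x.
  by move=> U0 _ /mapP[x /U0 x0 ->]; rewrite le_min x0.
have hi0 U : forall x, x \in map hi U -> 0 <= x.
  by move=> _ /mapP[x _ ->]; rewrite le_max lexx orbT.
have hiT U : sum_min U (map hi T) = \sum_(p <- U) \sum_(q <- T) Num.min p 0.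
  rewrite /sum_min; apply: eq_bigr => p _; rewrite big_map.
  rewrite big_seq [RHS]big_seq; apply: eq_bigr => q qT.
  by rewrite /hi max_r// subr_le0 le_seqmax.
have hiT0 U : (forall x, x \in U -> 0 <= x) -> sum_min U (map hi T) = 0.
  move=> U0; rewrite hiT big_seq big1// => p /U0 p0.
  by rewrite big1// => q _; rewrite min_r.
have -> : min_dist S T = min_dist (map lo S) (map lo T) + sum_min (map hi S) (map hi S).
  rewrite /min_dist (sum_minE S S) (sum_minE S T) (sum_minE T T) (hiT0 _ (hi0 S)) (hiT0 _ (hi0 T)).
  by ring.
have d0 := min_dist_ge0 (lo0 _ S0) (lo0 _ T0).
rewrite lerBlDr; apply: seqmax_le.
  by apply: addr_ge0 => //; apply: addr_ge0 => //; apply: sum_min_ge0; exact: hi0.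
(* One diagonal entry of the part above [t] suffices: [min (hi x) (hi x) = hi x >= x - t]. *)
move=> x xS; rewrite -lerBlDr; apply: (@le_trans _ _ (hi x)).
  by rewrite le_max lexx.
apply: ler_wpDl => //; apply: sum_min_diag_ge; first exact: hi0.
exact: map_f.
Qed.

Lemma dist_seqmax_le S T : (forall x, x \in S -> 0 <= x) ->
  (forall x, x \in T -> 0 <= x) -> `|seqmax S - seqmax T| <= min_dist S T.
Proof.
move=> S0 T0; rewrite ler_norml seqmaxB_le_min_dist// andbT lerNl opprB.
by rewrite min_distC seqmaxB_le_min_dist.
Qed.

Lemma sum_maxE S T : sum_max S T =
  (size T)%:R * (\sum_(x <- S) x) + (size S)%:R * (\sum_(x <- T) x) - sum_min S T.
Proof.
have -> : (size S)%:R * (\sum_(x <- T) x) = \sum_(p <- S) \sum_(q <- T) q.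
  by rewrite mulr_natl big_const_seq count_predT -Monoid.iteropE.
have -> : (size T)%:R * (\sum_(x <- S) x) = \sum_(p <- S) \sum_(q <- T) p.
  rewrite mulr_sumr; apply: eq_bigr => p _.
  by rewrite mulr_natl big_const_seq count_predT -Monoid.iteropE.
rewrite -big_split -sumrB; apply: eq_bigr => p _.
rewrite -big_split -sumrB; apply: eq_bigr => q _ /=.
by rewrite -(addr_max_min p q) addrK.
Qed.

End min_kernel.

(** * Cancellation along the chain of levels *)

Section chain.
Context {R : realFieldType}.
Implicit Types (L : nat -> seq R) (m a k : nat) (S : seq R).

(** The growth exponent of [mufun] in units of [pi / c]. A pair [r < s] contributes twice a maximum,
    hence the full double sum without its diagonal; at even levels the factors with argument
    [2 gamma / (ic)] add [2 |gamma|] and so reverse the sign of the diagonal term. *)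
Definition measure_expo a S : R :=
  sum_max S S + (if odd a then - \sum_(x <- S) x else \sum_(x <- S) x).

Definition gamma_expo m L : R :=
  \sum_(1 <= k < m) (sum_max (L k.*2) (L k.*2.-1) + sum_max (L k.*2) (L k.*2.+1)) +
  sum_max (L m.*2) (L m.*2.-1).

(** When level 0 is empty its [seqmax] is 0, so this total variation bounds every entry of the
    levels up to [2m]. *)
Definition max_variation m L : R := \sum_(a < m.*2) `|seqmax (L a.+1) - seqmax (L a)|.

(** Regroups the exponent by pairs of levels [2k], [2k + 1], together with the Gamma factors joining
    level [2k + 1] to both neighbours, so that the chain gains one term when [m] grows by 1. An
    empty level 0 contributes nothing to the link [k = 0]. *)
Let link L k : R := measure_expo k.*2 (L k.*2) + measure_expo k.*2.+1 (L k.*2.+1)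
    - sum_max (L k.*2) (L k.*2.+1) - sum_max (L k.+1.*2) (L k.*2.+1).

Let chain m L : R := \sum_(k < m) link L k.

Let chainS m L : chain m.+1 L = chain m L + link L m.
Proof. exact: big_ord_recr. Qed.

Lemma sum_max_nil S : sum_max [::] S = 0.
Proof. by rewrite /sum_max big_nil. Qed.

Let chainE m L : (0 < m)%N -> L 0%N = [::] ->
  \sum_(1 <= a < m.*2) measure_expo a (L a) - gamma_expo m L = chain m L.
Proof.
move=> m0 L0; case: m m0 => // m _; elim: m => [|m IH].
  rewrite chainS /chain big_ord0 /link /gamma_expo !big_nat1 big_geq// L0 /= !sum_max_nil.
  rewrite [measure_expo 0 _]/measure_expo sum_max_nil big_nil !double0 /= oppr0; ring.
rewrite {1}/gamma_expo doubleS big_nat_recr//= big_nat_recr//=.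
rewrite [X in _ - (X + _)]big_nat_recr//=.
rewrite chainS -IH /link /gamma_expo doubleS /=.
by ring.
Qed.

(** The invariant keeps the boundary terms of level [2m], whose measure enters only with the next
    link. That link cancels the linear terms of levels [2m] and [2m + 1], completes two distances
    [min_dist], and leaves the same boundary terms at level [2m + 2]. *)
Let chain_le m L : (forall a, (a <= m.*2)%N -> size (L a) = uphalf a) ->
  (forall a x, (a <= m.*2)%N -> x \in L a -> 0 <= x) ->
  chain m L <= 2^-1 * sum_min (L m.*2) (L m.*2) - m%:R * (\sum_(x <- L m.*2) x)
               - 2^-1 * max_variation m L.
Proof.
elim: m => [|m IH] sL L0.
  rewrite /chain big_ord0 /max_variation big_ord0 mul0r !subr0.
  have /size0nil -> := sL 0%N (leqnn _).
  by rewrite /sum_min big_nil mulr0.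
have le1 : (m.*2 <= m.+1.*2)%N by rewrite leq_double.
have le2 : (m.*2.+1 <= m.+1.*2)%N by rewrite doubleS.
have /(_ _ _)/wrap[] := IH.
- by move=> a am; apply: sL; exact: leq_trans am le1.
- by move=> a x am; apply: L0; exact: leq_trans am le1.
rewrite chainS => H.
have -> : max_variation m.+1 L = max_variation m L +
   `|seqmax (L m.*2.+1) - seqmax (L m.*2)| +
   `|seqmax (L m.*2.+2) - seqmax (L m.*2.+1)|.
  by rewrite /max_variation doubleS !big_ord_recr.
have d1 := @dist_seqmax_le _ (L m.*2.+1) (L m.*2) (fun x => L0 _ x le2)
  (fun x => L0 _ x le1).
have d2 := @dist_seqmax_le _ (L m.*2.+2) (L m.*2.+1) (fun x => L0 _ x (leqnn _))
  (fun x => L0 _ x le2).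
move: H d1 d2; rewrite /link /measure_expo /= odd_double /= !sum_maxE /min_dist.
rewrite !sL//= !doubleS /= uphalf_double doubleK.
rewrite (sum_minC (L m.*2.+1) (L m.*2)).
rewrite -(natr1 m).
lra.
Qed.

(** The linear remainder at level [2m] has a favourable sign and is dropped; the quadratic one will
    only involve the fixed parameters. *)
Lemma measure_gamma_expo_le m L : (0 < m)%N ->
  (forall a, (a <= m.*2)%N -> size (L a) = uphalf a) ->
  (forall a x, (a <= m.*2)%N -> x \in L a -> 0 <= x) ->
  \sum_(1 <= a < m.*2) measure_expo a (L a) - gamma_expo m L <=
  2^-1 * sum_min (L m.*2) (L m.*2) - 2^-1 * max_variation m L.
Proof.
move=> m0 sL L0; rewrite chainE//; last exact/size0nil/(sL 0%N).
apply: (le_trans (chain_le sL L0)); rewrite lerD2r lerBlDr lerDl mulr_ge0//.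
by rewrite big_seq; apply: sumr_ge0 => x; exact: L0.
Qed.

Lemma le_max_variation m L a x : L 0%N = [::] -> (a <= m.*2)%N -> x \in L a ->
  x <= max_variation m L.
Proof.
move=> L0 am /le_seqmax/le_trans; apply.
apply: (@le_trans _ _ (\sum_(b < a) `|seqmax (L b.+1) - seqmax (L b)|)).
  elim: a {am} => [|a IH]; first by rewrite L0 /seqmax big_nil big_ord0.
  rewrite big_ord_recr /= -lerBlDl.
  apply: le_trans (_ : seqmax (L a.+1) - seqmax (L a) <= _).
    by rewrite lerD2l lerN2.
  exact: ler_norm.
rewrite /max_variation -(subnKC am) big_split_ord /= lerDl.
by apply: sumr_ge0.
Qed.

Lemma sum_max_bound S T w : (forall x, x \in S -> x <= w) ->
  (forall x, x \in T -> x <= w) -> sum_max S T <= (size S * size T)%:R * w.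
Proof.
move=> Sw Tw; rewrite /sum_max big_seq.
apply: (@le_trans _ _ (\sum_(p <- S | p \in S) (size T)%:R * w)).
  apply: ler_sum => p /Sw pw; rewrite big_seq.
  apply: (@le_trans _ _ (\sum_(q <- T | q \in T) w)).
    by apply: ler_sum => q /Tw qw; rewrite ge_max pw.
  by rewrite -big_seq big_const_seq count_predT -Monoid.iteropE mulr_natl.
by rewrite -big_seq big_const_seq count_predT -Monoid.iteropE natrM -mulrA [leRHS]mulr_natl.
Qed.

(** Controls the loss, which multiplies the sum of the two exponents where the main term has their
    difference. A crude linear bound is enough, but [K] must depend on [m] alone, as the rate of
    loss is chosen from it. *)
Lemma expo_bound m : exists2 K : R, 0 < K & forall L w, 0 <= w ->
  (forall a, (a <= m.*2)%N -> size (L a) = uphalf a) ->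
  (forall a x, (a <= m.*2)%N -> x \in L a -> 0 <= x <= w) ->
  \sum_(1 <= a < m.*2) measure_expo a (L a) + gamma_expo m L <= K * w.
Proof.
pose N := m.*2; pose c := (N * N)%:R : R.
have c0 : 0 <= c by [].
exists (1 + (N%:R * (c + N%:R) + (m%:R * (c + c) + c))) => [|L w w0 sL Lw].
  by rewrite ltr_pwDl// !addr_ge0// mulr_ge0// addr_ge0.
have szN a : (a <= N)%N -> (size (L a) <= N)%N.
  by move=> aN; rewrite sL// (leq_trans _ aN)// leq_uphalf_double -addnn leq_addr.
have Lw' a x : (a <= N)%N -> x \in L a -> x <= w.
  by move=> aN xa; have /andP[] := Lw _ _ aN xa.
have H a b : (a <= N)%N -> (b <= N)%N -> sum_max (L a) (L b) <= c * w.
  move=> aN bN; apply: (le_trans (@sum_max_bound _ _ w _ _)) => [x|x|].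
  - exact: Lw'.
  - exact: Lw'.
  - by rewrite ler_wpM2r// ler_nat leq_mul ?szN.
have H' a : (a <= N)%N -> \sum_(x <- L a) x <= N%:R * w.
  move=> aN; apply: (@le_trans _ _ ((size (L a))%:R * w)).
    rewrite big_seq; apply: (@le_trans _ _ (\sum_(x <- L a | x \in L a) w)).
      by apply: ler_sum => x; exact: Lw'.
    by rewrite -big_seq big_const_seq count_predT -Monoid.iteropE mulr_natl.
  by rewrite ler_wpM2r// ler_nat szN.
have sum0 a : (a <= N)%N -> 0 <= \sum_(x <- L a) x.
  by move=> aN; rewrite big_seq; apply: sumr_ge0 => x /(Lw _ _ aN)/andP[].
rewrite mulrDl mul1r; apply: ler_wpDl => //; rewrite mulrDl.
apply: lerD.
  apply: (@le_trans _ _ (\sum_(1 <= a < N) (c * w + N%:R * w))).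
    rewrite !big_nat; apply: ler_sum => a /andP[_ /ltnW aN].
    apply: lerD; first exact: H.
    case: odd; last exact: H'.
    by apply: le_trans (H' _ aN); rewrite ge0_cp// sum0.
  rewrite -mulrDl big_const_nat -Monoid.iteropE -[leLHS]mulr_natl -mulrA.
  by rewrite ler_wpM2r ?ler_nat ?leq_subr// mulr_ge0// addr_ge0.
rewrite /gamma_expo mulrDl; apply: lerD; last first.
  by apply: H => //; exact: leq_pred.
apply: (@le_trans _ _ (\sum_(1 <= a < m) (c * w + c * w))).
  rewrite !big_nat; apply: ler_sum => a /andP[_ am].
  have aN : (a.*2.+1 <= N)%N by rewrite /N; lia.
  by apply: lerD; apply: H; lia.
rewrite -mulrDl big_const_nat -Monoid.iteropE -[leLHS]mulr_natl -mulrA.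
by rewrite ler_wpM2r ?ler_nat ?leq_subr// mulr_ge0// addr_ge0.
Qed.

End chain.

(** * Fubini on tuples *)

Section tuple_cat.
Context {R : realType}.

(** The length [N] is tied to [p + q] only through [e], so that tuples of length [(m + 1) ^ 2] can
    be cut into blocks of lengths [m ^ 2], [m] and [m + 1]. *)
Definition tcat p q N (e : (p + q = N)%N) (z : p.-tuple R * q.-tuple R) :
  N.-tuple R := tcast e [tuple of z.1 ++ z.2].

Lemma measurable_nth n i : measurable_fun setT (fun t : n.-tuple R => t`_i).
Proof.
have [ni|ni] := ltnP i n; last first.
  rewrite (_ : (fun _ => _) = cst 0); first exact: measurable_cst.
  by apply/funext => t; rewrite nth_default// size_tuple.
rewrite (_ : (fun _ => _) = (fun t => tnth t (Ordinal ni))).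
  exact: measurable_tnth.
by apply/funext => t; rewrite (tnth_nth 0).
Qed.

Lemma measurable_tcat p q N (e : (p + q = N)%N) : measurable_fun setT (tcat e).
Proof.
apply/measurable_fun_tnthP => i.
have [ip|ip] := ltnP i p.
  apply: (eq_measurable_fun (fun z : p.-tuple R * q.-tuple R => z.1`_i)).
    by move=> z _ /=; rewrite (tnth_nth 0) val_tcast /= nth_cat size_tuple ip.
  by apply: (measurableT_comp (measurable_nth _)); exact: measurable_fst.
apply: (eq_measurable_fun (fun z : p.-tuple R * q.-tuple R => z.2`_(i - p))).
  move=> z _ /=; rewrite (tnth_nth 0) val_tcast /= nth_cat size_tuple.
  by rewrite ltnNge ip.
by apply: (measurableT_comp (measurable_nth _)); exact: measurable_snd.
Qed.

Local Open Scope ereal_scope.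

Lemma ge0_integral_tupleS n (f : n.+1.-tuple R -> \bar R) :
  measurable_fun setT f -> (forall t, 0 <= f t) ->
  \int[lebesgue_tuple R n.+1]_t f t =
  \int[lebesgue_measure]_x \int[lebesgue_tuple R n]_t f (cons_pair (x, t)).
Proof.
move=> mf f0.
have mc : measurable_fun [set: measurableTypeR R * n.-tuple R] (@cons_pair R n).
  exact: measurable_cons_pair.
transitivity (\int[pushforward (lebesgue_measure \x lebesgue_tuple R n)
  (@cons_pair R n)]_t f t) => //.
rewrite (ge0_integral_pushforward mc)// preimage_setT fubini_tonelli1//.
  exact: measurableT_comp.
by move=> x; exact: f0.
Qed.

Lemma measurable_integral_tcat p q N (e : (p + q = N)%N) (f : N.-tuple R -> \bar R) :
  measurable_fun setT f -> (forall t, 0 <= f t) ->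
  measurable_fun setT (fun u => \int[lebesgue_tuple R q]_v f (tcat e (u, v))).
Proof.
move=> mf f0; apply: (measurable_fun_fubini_tonelli_F (f \o tcat e)) => [|z].
  exact: (measurableT_comp mf (measurable_tcat e)).
exact: f0.
Qed.

(** The coordinates of the first block are peeled off from the head, following the recursive
    construction of the measure, down to the Dirac mass at the empty tuple. *)
Lemma ge0_integral_tcat p q N (e : (p + q = N)%N) (f : N.-tuple R -> \bar R) :
  measurable_fun setT f -> (forall t, 0 <= f t) ->
  \int[lebesgue_tuple R N]_t f t =
  \int[lebesgue_tuple R p]_u \int[lebesgue_tuple R q]_v f (tcat e (u, v)).
Proof.
elim: p N e f => [|p IH] N e f mf f0.
  rewrite /= integral_dirac//=; last exact: measurable_integral_tcat.
  rewrite diracT mul1e; subst N; apply: eq_integral => t _; congr f.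
  by apply: val_inj.
case: N e f mf f0 => // N e f mf f0.
have e' : (p + q = N)%N by case: e.
rewrite ge0_integral_tupleS// [RHS]ge0_integral_tupleS//; first last.
- by move=> t; apply: integral_ge0.
- exact: measurable_integral_tcat.
apply: eq_integral => x _; rewrite (IH _ e')//; last first.
  apply: (measurableT_comp mf); apply: (measurableT_comp (@measurable_cons_pair R N)).
  exact: measurable_pair1.
apply: eq_integral => u _; apply: eq_integral => v _; congr f.
by apply: val_inj; rewrite /= !val_tcast.
Qed.

Lemma integral_tcat p q N (e : (p + q = N)%N) (f : N.-tuple R -> \bar R) :
  measurable_fun setT f ->
  \int[lebesgue_tuple R N]_t f t =
  \int[lebesgue_tuple R p \x lebesgue_tuple R q]_z f (tcat e z).
Proof.
move=> mf; have H g : measurable_fun setT g -> (forall t, 0 <= g t) ->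
    \int[lebesgue_tuple R N]_t g t =
    \int[lebesgue_tuple R p \x lebesgue_tuple R q]_z g (tcat e z).
  move=> mg g0; rewrite (ge0_integral_tcat e)//.
  rewrite (fubini_tonelli1 (g \o tcat e))// => [|z]; last exact: g0.
  exact: (measurableT_comp mg (measurable_tcat e)).
rewrite [LHS]integralE [RHS]integralE (H f^\+)//; last exact: measurable_funepos.
rewrite (H f^\-)//; last exact: measurable_funeneg.
by congr (_ - _); apply: eq_integral => z _; rewrite ?funeposE ?funenegE.
Qed.

(** The universal dominating function: integrable in every dimension and multiplicative under
    concatenation. *)
Definition lweight (s : seq R) : R := \prod_(x <- s) (1 + x ^+ 2)^-1.

Lemma lweight_ge0 s : (0 <= lweight s)%R.
Proof. by apply: prodr_ge0 => x _; rewrite invr_ge0 addr_ge0 ?sqr_ge0. Qed.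

Lemma lweight_tcat p q N (e : (p + q = N)%N) u v :
  lweight (tcat e (u, v)) = (lweight u * lweight v)%R.
Proof. by rewrite /lweight /= val_tcast /= big_cat. Qed.

Lemma measurable_lweight n : measurable_fun setT (fun t : n.-tuple R => lweight t).
Proof.
apply: (eq_measurable_fun (fun t : n.-tuple R => \prod_(i < n) (1 + t`_i ^+ 2)^-1)%R).
  by move=> t _; rewrite /lweight (big_nth 0%R) size_tuple big_mkord.
apply: measurable_prod => i _; apply: measurable_funV; apply: measurable_funD => //.
by apply: measurable_funX; exact: measurable_nth.
Qed.

Lemma integral_oneDsqrV_lty :
  \int[lebesgue_measure]_x ((1 + x ^+ 2)^-1)%:E < +oo :> \bar R.
Proof.
rewrite ge0_symfun_integralT.
- rewrite (_ : [set x | (0 <= x)%R] = `[0%R, +oo[%classic); last first.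
    by apply/seteqP; split => x /=; rewrite in_itv/= andbT.
  by rewrite [X in 2 * X](@integral0y_oneDsqr R) -EFinM ltry.
- by move=> x; rewrite invr_ge0 addr_ge0 ?sqr_ge0.
- exact: continuous_oneDsqrV.
- by move=> x /=; rewrite sqrrN.
Qed.

Lemma integral_lweight_lty n : \int[lebesgue_tuple R n]_t (lweight t)%:E < +oo.
Proof.
have ml n' : measurable_fun setT (fun t : n'.-tuple R => (lweight t)%:E).
  by apply/measurable_EFinP; exact: measurable_lweight.
have w0 (x : R) : 0 <= ((1 + x ^+ 2)^-1)%:E :> \bar R.
  by rewrite lee_fin invr_ge0 addr_ge0 ?sqr_ge0.
have l0 n' (t : n'.-tuple R) : 0 <= (lweight t)%:E by rewrite lee_fin lweight_ge0.
elim: n => [|n IH].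
  rewrite /= integral_dirac//=; last exact: ml.
  by rewrite diracT mul1e ltry.
rewrite ge0_integral_tupleS//.
have E (x : R) : \int[lebesgue_tuple R n]_t (lweight (cons_pair (x, t)))%:E =
    ((1 + x ^+ 2)^-1)%:E * \int[lebesgue_tuple R n]_t (lweight t)%:E.
  rewrite -ge0_integralZl//; last exact: ml.
  apply: eq_integral => t _.
  by rewrite /lweight /= big_cons EFinM.
under eq_integral do rewrite E.
rewrite ge0_integralZr//.
- rewrite lte_mul_pinfty//.
  + exact: integral_ge0.
  + by rewrite ge0_fin_numE ?integral_oneDsqrV_lty//; exact: integral_ge0.
- apply/measurable_EFinP; apply: continuous_measurable_fun.
  exact: continuous_oneDsqrV.
- exact: integral_ge0.
Qed.

Lemma integrable_lweight n :
  (lebesgue_tuple R n).-integrable setT (fun t => (lweight t)%:E).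
Proof.
apply/integrableP; split; first by apply/measurable_EFinP; exact: measurable_lweight.
under eq_integral => t _ do rewrite gee0_abs ?lee_fin ?lweight_ge0//.
exact: integral_lweight_lty.
Qed.

Local Close Scope ereal_scope.

(** Unlike integrability, this passes to every slice and to partial integrals, because [lweight]
    splits. Iterated integrals thus need no exceptional null sets. *)
Definition dominated n (f : n.-tuple R -> R) :=
  measurable_fun setT f /\ exists C, forall t, `|f t| <= C * lweight t.

Lemma dominated_integrable n (f : n.-tuple R -> R) : dominated f ->
  (lebesgue_tuple R n).-integrable setT (EFin \o f).
Proof.
move=> [mf [C fC]].
apply: (@le_integrable _ _ _ (lebesgue_tuple R n) setT measurableT (EFin \o f)
  (fun t => (C * lweight t)%:E)).
- exact/measurable_EFinP.
- by move=> t _ /=; rewrite lee_fin (le_trans (fC t))// ler_norm.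
- under eq_fun do rewrite EFinM.
  by apply: integrableZl => //; exact: integrable_lweight.
Qed.

Lemma dominated_Rintegral_le n (f : n.-tuple R -> R) C : measurable_fun setT f ->
  (forall t, `|f t| <= C * lweight t) ->
  `|\int[lebesgue_tuple R n]_t f t| <= C * \int[lebesgue_tuple R n]_t lweight t.
Proof.
move=> mf fC; have If : dominated f by split => //; exists C.
have Iw : dominated (fun t : n.-tuple R => lweight t).
  split; first exact: measurable_lweight.
  by exists 1 => t; rewrite mul1r ger0_norm ?lweight_ge0.
apply: (le_trans (le_normr_Rintegral _ (dominated_integrable If))) => //.
rewrite -RintegralZl//; last exact: dominated_integrable.
apply: le_Rintegral => //.
- apply: dominated_integrable; split; first exact: measurableT_comp.
  by exists C => t; rewrite normr_id.
- apply: dominated_integrable; split.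
    by apply: measurable_funM => //; exact: measurable_lweight.
  by exists `|C| => t; rewrite normrM (ger0_norm (lweight_ge0 _)).
Qed.

Section split.
Variables (p q N : nat) (e : (p + q = N)%N) (f : N.-tuple R -> R).
Hypothesis df : dominated f.

Let integrable_tcat : (lebesgue_tuple R p \x lebesgue_tuple R q)%E.-integrable setT
  (fun z => (f (tcat e z))%:E).
Proof.
have [mf _] := df; apply/integrableP; split.
  by apply/measurable_EFinP; exact: (measurableT_comp mf (measurable_tcat e)).
rewrite -(@integral_tcat _ _ _ e (fun t => `|(f t)%:E|%E)).
  by have /integrableP[] := dominated_integrable df.
by apply: measurableT_comp => //; exact/measurable_EFinP.
Qed.

Lemma dominated_tcat1 v : dominated (fun u => f (tcat e (u, v))).
Proof.
have [mf [C fC]] := df; split.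
  apply: (measurableT_comp mf); apply: (measurableT_comp (measurable_tcat e)).
  exact: pair2_measurable.
exists (C * lweight v) => u.
by rewrite mulrAC -mulrA -(lweight_tcat e).
Qed.

Lemma dominated_tcat2 u : dominated (fun v => f (tcat e (u, v))).
Proof.
have [mf [C fC]] := df; split.
  apply: (measurableT_comp mf); apply: (measurableT_comp (measurable_tcat e)).
  exact: pair1_measurable.
by exists (C * lweight u) => v; rewrite -mulrA -(lweight_tcat e).
Qed.

Lemma dominated_Rintegral_tcat1 :
  dominated (fun u => \int[lebesgue_tuple R q]_v f (tcat e (u, v))).
Proof.
have [mf [C fC]] := df; split.
  apply: measurableT_comp => //.
  exact: (measurable_fubini_F integrable_tcat).
exists (C * \int[lebesgue_tuple R q]_t lweight t) => u.
rewrite mulrAC; apply: dominated_Rintegral_le; first by case: (dominated_tcat2 u).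
by move=> v; rewrite -mulrA -(lweight_tcat e).
Qed.

Lemma Rintegral_tcat12 : \int[lebesgue_tuple R N]_t f t =
  \int[lebesgue_tuple R p]_u \int[lebesgue_tuple R q]_v f (tcat e (u, v)).
Proof.
have [mf _] := df.
rewrite /Rintegral (integral_tcat e); last exact/measurable_EFinP.
rewrite -(integral12_prod_meas1 integrable_tcat); congr fine.
apply: eq_integral => u _; rewrite fineK//.
exact: (integrable_fin_num measurableT (dominated_integrable (dominated_tcat2 u))).
Qed.

Lemma Rintegral_tcat21 : \int[lebesgue_tuple R N]_t f t =
  \int[lebesgue_tuple R q]_v \int[lebesgue_tuple R p]_u f (tcat e (u, v)).
Proof.
have [mf _] := df.
rewrite /Rintegral (integral_tcat e); last exact/measurable_EFinP.
rewrite -(integral21_prod_meas1 integrable_tcat); congr fine.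
apply: eq_integral => v _; rewrite fineK//.
exact: (integrable_fin_num measurableT (dominated_integrable (dominated_tcat1 v))).
Qed.

End split.

End tuple_cat.

(** * Iterated integrals of complex-valued functions *)

Section complex_integral.
Context {R : realType}.
Local Notation leb := (lebesgue_tuple R).

Definition cdominated n (f : n.-tuple R -> R[i]) :=
  dominated (fun t => complex.Re (f t)) /\ dominated (fun t => complex.Im (f t)).

Lemma cdominatedP n (f : n.-tuple R -> R[i]) C : cmeasurable f ->
  (forall t, normc (f t) <= C * lweight t) -> cdominated f.
Proof.
move=> [mr mi] fC; split; split => //; exists C => t.
  exact: le_trans (normrRe_le_normc _) (fC t).
exact: le_trans (normrIm_le_normc _) (fC t).
Qed.

Lemma CintegralZl n k (f : n.-tuple R -> R[i]) : cdominated f ->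
  Cintegral (leb n) (fun t => k * f t) = k * Cintegral (leb n) f.
Proof.
case: k => a b [dr di]; rewrite /Cintegral.
have ir := dominated_integrable dr; have ii := dominated_integrable di.
have iZ (x : R) (h : n.-tuple R -> R) : (leb n).-integrable setT (EFin \o h) ->
    (leb n).-integrable setT (EFin \o (fun t => x * h t)).
  by move=> ih; rewrite /comp; under eq_fun do rewrite EFinM; exact: integrableZl.
apply/eqP; rewrite eq_complex; apply/andP; split; apply/eqP => /=.
  rewrite -!RintegralZl// -RintegralB//; [|exact: iZ|exact: iZ].
  by apply: eq_Rintegral => t _; case: (f t).
rewrite -!RintegralZl// -RintegralD//; [|exact: iZ|exact: iZ].
by apply: eq_Rintegral => t _; case: (f t).
Qed.

Lemma eq_Cintegral n (f g : n.-tuple R -> R[i]) : f =1 g ->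
  Cintegral (leb n) f = Cintegral (leb n) g.
Proof. by move=> /funext ->. Qed.

Lemma Cintegral0 n : Cintegral (leb n) (fun=> 0) = 0.
Proof.
by rewrite /Cintegral /= /Rintegral integral0.
Qed.

Section split.
Variables (p q N : nat) (e : (p + q = N)%N) (f : N.-tuple R -> R[i]).
Hypothesis df : cdominated f.

Lemma cdominated_Cintegral_tcat :
  cdominated (fun u => Cintegral (leb q) (fun v => f (tcat e (u, v)))).
Proof.
by have [dr di] := df; split;
  [exact: (dominated_Rintegral_tcat1 e dr)|exact: (dominated_Rintegral_tcat1 e di)].
Qed.

Lemma Cintegral_tcat12 : Cintegral (leb N) f =
  Cintegral (leb p) (fun u => Cintegral (leb q) (fun v => f (tcat e (u, v)))).
Proof.
have [dr di] := df.
by rewrite /Cintegral (Rintegral_tcat12 e dr) (Rintegral_tcat12 e di).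
Qed.

Lemma Cintegral_tcat21 : Cintegral (leb N) f =
  Cintegral (leb q) (fun v => Cintegral (leb p) (fun u => f (tcat e (u, v)))).
Proof.
have [dr di] := df.
by rewrite /Cintegral (Rintegral_tcat21 e dr) (Rintegral_tcat21 e di).
Qed.

End split.

(** The middle block is moved outermost: in the application it is level [2n-2], the only one shared
    by the two factors of the integrand. *)
Lemma Cintegral_tcat3 p q P r N (e2 : (p + q = P)%N) (e1 : (P + r = N)%N)
    (f : N.-tuple R -> R[i]) : cdominated f ->
  Cintegral (leb N) f =
  Cintegral (leb q) (fun v => Cintegral (leb p) (fun u =>
    Cintegral (leb r) (fun w => f (tcat e1 (tcat e2 (u, v), w))))).
Proof.
move=> df; rewrite (Cintegral_tcat12 e1 df).
by rewrite (Cintegral_tcat21 e2 (cdominated_Cintegral_tcat e1 df)).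
Qed.

(* Domination of the product bounds each factor by evaluating the other one
   at a point where it does not vanish. *)
Lemma Cintegral_prod p r (m k : R[i]) (a : p.-tuple R -> R[i])
    (b : r.-tuple R -> R[i]) C : cmeasurable a -> cmeasurable b ->
  (forall u w, normc (m * a u * (k * b w)) <= C * (lweight u * lweight w)) ->
  Cintegral (leb p) (fun u => Cintegral (leb r) (fun w => m * a u * (k * b w))) =
  k * Cintegral (leb r) b * Cintegral (leb p) a * m.
Proof.
move=> ma mb H.
(* In the degenerate cases there is no point at which to evaluate the other factor, but both sides
   are then 0. *)
have [->|m0] := eqVneq m 0.
  rewrite mulr0 -[RHS](Cintegral0 p); apply: eq_Cintegral => u.
  by rewrite -[RHS](Cintegral0 r); apply: eq_Cintegral => w; rewrite !mul0r.
have [->|k0] := eqVneq k 0.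
  rewrite !mul0r -[RHS](Cintegral0 p); apply: eq_Cintegral => u.
  by rewrite -[RHS](Cintegral0 r); apply: eq_Cintegral => w; rewrite mul0r mulr0.
have [a0|/existsNP[u0 /eqP u00]] := pselect (forall u, a u = 0).
  rewrite (_ : a = fun=> 0) ?Cintegral0 ?mulr0 ?mul0r; last exact/funext.
  rewrite -[RHS](Cintegral0 p); apply: eq_Cintegral => u.
  by rewrite -[RHS](Cintegral0 r); apply: eq_Cintegral => w; rewrite mul0r.
have [b0|/existsNP[w0 /eqP w00]] := pselect (forall w, b w = 0).
  rewrite (_ : b = fun=> 0) ?Cintegral0 ?mulr0 ?mul0r; last exact/funext.
  rewrite -[RHS](Cintegral0 p); apply: eq_Cintegral => u.
  by rewrite -[RHS](Cintegral0 r); apply: eq_Cintegral => w; rewrite !mulr0.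
have normc_gt0 (z : R[i]) : z != 0 -> 0 < normc z.
  move=> z0; rewrite lt_neqAle normc_ge0 andbT eq_sym.
  by apply: contra_neq z0; exact: ComplexField.Normc.eq0_normc.
have db : cdominated b.
  apply: (@cdominatedP _ _ (C * lweight u0 / (normc (m * a u0) * normc k)) mb) => w.
  rewrite mulrAC ler_pdivlMr ?mulr_gt0 ?normc_gt0 ?mulf_neq0//.
  have := H u0 w; rewrite (ComplexField.Normc.normcM (m * a u0)).
  rewrite (ComplexField.Normc.normcM k) => h.
  rewrite (_ : normc (b w) * _ = normc (m * a u0) * (normc k * normc (b w))); last by ring.
  by apply: le_trans h _; rewrite le_eqVlt; apply/orP; left; apply/eqP; ring.
have da : cdominated a.
  apply: (@cdominatedP _ _ (C * lweight w0 / (normc (k * b w0) * normc m)) ma) => u.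
  rewrite mulrAC ler_pdivlMr ?mulr_gt0 ?normc_gt0 ?mulf_neq0//.
  have := H u w0; rewrite (ComplexField.Normc.normcM (m * a u)).
  rewrite (ComplexField.Normc.normcM m) => h.
  rewrite (_ : normc (a u) * _ = normc m * normc (a u) * normc (k * b w0)); last by ring.
  by apply: le_trans h _; rewrite le_eqVlt; apply/orP; left; apply/eqP; ring.
transitivity (Cintegral (leb p) (fun u => (m * (k * Cintegral (leb r) b)) * a u)).
  apply: eq_Cintegral => u.
  rewrite (_ : (fun w => _) = (fun w => (m * a u * k) * b w)).
    by rewrite CintegralZl//; ring.
  by apply/funext => w; ring.
by rewrite CintegralZl//; ring.
Qed.

End complex_integral.

(** * Measurability and growth of the integrands *)

Section integrand_measurability.
Context {R : realType} d (T : measurableType d).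
Variable c : R.

Lemma cmeasurable_GammaV2 (h : T -> R) (z : R[i]) : measurable_fun setT h ->
  cmeasurable (fun t => `|Gamma (z + (h t)%:C / (0 +i* c))| ^- 2).
Proof.
move=> mh; apply: cmeasurable_normV2; apply: cmeasurable_Gamma.
apply: cmeasurableD; first exact: cmeasurable_cst.
by apply: cmeasurableM; [exact: cmeasurable_real|exact: cmeasurable_cst].
Qed.

Lemma cmeasurable_GammaV2_0 (h : T -> R) : measurable_fun setT h ->
  cmeasurable (fun t => `|Gamma ((h t)%:C / (0 +i* c))| ^- 2).
Proof.
by move/(cmeasurable_GammaV2 0); under eq_fun do rewrite add0r.
Qed.

Lemma cmeasurable_Gamma_half (h h' : T -> R) : measurable_fun setT h ->
  measurable_fun setT h' -> cmeasurable (fun t => Gamma_half c (h t) (h' t)).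
Proof.
move=> mh mh'; rewrite /Gamma_half /Gamma_pm.
have m1 : cmeasurable (fun t => (h t)%:C / (0 +i* c)).
  by apply: cmeasurableM; [exact: cmeasurable_real|exact: cmeasurable_cst].
have m2 : cmeasurable (fun t => (h' t)%:C / (0 +i* c) + 2%:R^-1).
  apply: cmeasurableD; last exact: cmeasurable_cst.
  by apply: cmeasurableM; [exact: cmeasurable_real|exact: cmeasurable_cst].
apply: cmeasurableM; apply: cmeasurable_Gamma; apply: cmeasurableD => //.
exact: cmeasurableN.
Qed.

Lemma cmeasurable_mufun a (g : T -> seq R) :
  (forall i, measurable_fun setT (fun t => (g t)`_i)) ->
  cmeasurable (fun t => mufun c a (g t)).
Proof.
move=> mg; rewrite /mufun; case: odd.
  rewrite /mu_odd; apply: cmeasurable_prod => s _; apply: cmeasurable_prod => r _.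
  apply: cmeasurableM.
    by apply: cmeasurable_GammaV2_0; exact: measurable_funB.
  by apply: cmeasurable_GammaV2; exact: measurable_funD.
rewrite /mu_even; apply: cmeasurableM.
  apply: cmeasurable_prod => s _; apply: cmeasurable_prod => r _.
  by apply: cmeasurableM; apply: cmeasurable_GammaV2_0;
    [exact: measurable_funB|exact: measurable_funD].
apply: cmeasurable_prod => r _; apply: cmeasurable_GammaV2_0.
exact: measurable_funM.
Qed.

End integrand_measurability.

Section integrands.
Context {R : realType}.
Variable c : R.

Lemma deltaE (s : seq R) n : (size s <= n)%N -> delta s = \sum_(i < n) s`_i.
Proof.
move=> sn; rewrite /delta (big_nth 0) big_mkord (big_ord_widen _ _ sn).
rewrite big_mkcond /=; apply: eq_bigr => i _; case: ltnP => // si.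
by rewrite nth_default.
Qed.

Lemma measurable_level N a i :
  measurable_fun setT (fun t : N.-tuple R => (level t a)`_i).
Proof.
rewrite /level; have [ia|ia] := ltnP i (uphalf a).
  rewrite (_ : (fun _ => _) = (fun t : N.-tuple R => t`_(a./2 * uphalf a + i))).
    exact: measurable_nth.
  by apply/funext => t; rewrite nth_take// nth_drop.
rewrite (_ : (fun _ => _) = cst 0); first exact: measurable_cst.
apply/funext => t; rewrite nth_default// size_take.
by case: ltnP => // /leq_trans; apply.
Qed.

Lemma size_level N (t : N.-tuple R) a : (size (level t a) <= uphalf a)%N.
Proof. by rewrite /level size_take; case: ltnP. Qed.

Lemma measurable_delta_level N a :
  measurable_fun setT (fun t : N.-tuple R => delta (level t a)).
Proof.
rewrite (_ : (fun _ => _) =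
  (fun t : N.-tuple R => \sum_(i < uphalf a) (level t a)`_i)); last first.
  by apply/funext => t; exact/deltaE/size_level.
by apply: measurable_sum => i; exact: measurable_level.
Qed.

Lemma cmeasurable_Whittaker_integrand m (g x : m.-tuple R) :
  cmeasurable (Whittaker_integrand c g x).
Proof.
rewrite /Whittaker_integrand.
set deltap := fun (t : (m ^ 2).-tuple R) (k : nat) =>
  if k is k'.+1 then delta (level t k'.*2.+1) else 0.
have md k : measurable_fun setT (fun t => deltap t k).
  by case: k => [|k]; [exact: measurable_cst|exact: measurable_delta_level].
apply: cmeasurableM; [apply: cmeasurableM; [apply: cmeasurableM;
  [apply: cmeasurableM|]|]|].
- by apply: cmeasurable_prod => a _; apply: cmeasurable_mufun => i; exact: measurable_level.
- apply: cmeasurable_Cexp; apply: cmeasurableM; last exact: cmeasurable_cst.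
  apply: cmeasurableM; first exact: cmeasurable_cst.
  by apply: cmeasurable_real; apply: measurable_sum => k; exact: md.
- apply: cmeasurable_Cexp; apply: cmeasurableM; first exact: cmeasurable_cst.
  apply: cmeasurable_sum => k _; apply: cmeasurableM; last exact: cmeasurable_cst.
  apply: cmeasurableD; last exact: cmeasurable_cst.
  by apply: cmeasurable_real; apply: measurable_funB; exact: md.
- apply: cmeasurable_prod => k _; apply: cmeasurable_prod => p _.
  apply: cmeasurableM; apply: cmeasurable_prod => j _; apply: cmeasurable_Gamma_half.
  + exact: measurable_level.
  + exact: measurable_level.
  + exact: measurable_level.
  + by apply: measurable_funN; exact: measurable_level.
- apply: cmeasurable_prod => p _; apply: cmeasurable_prod => j _.
  by apply: cmeasurable_Gamma_half; [exact: measurable_cst|exact: measurable_level].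
Qed.

Definition kernel_integrand n (g2n : n.-tuple R) (g2n2 : seq R) (y : R)
    (h : n.-tuple R) : R[i] :=
  mufun c n.*2.-1 h * Cpow c (2%:R / (0 +i* c) * (delta h)%:C) *
  Cexp (- ((delta h)%:C / (0 +i* c)) * y%:C) *
  (\prod_(p < n.-1) \prod_(l < n) Gamma_half c g2n2`_p (- h`_l)) *
  \prod_(p < n) \prod_(j < n) Gamma_half c g2n`_p h`_j.

Lemma cmeasurable_kernel_integrand n (g2n : n.-tuple R) (g2n2 : seq R) (y : R) :
  cmeasurable (kernel_integrand g2n g2n2 y).
Proof.
have md : measurable_fun setT (fun h : n.-tuple R => delta h).
  rewrite (_ : (fun _ => _) = (fun h : n.-tuple R => \sum_(i < n) h`_i)).
    by apply: measurable_sum => i; exact: measurable_nth.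
  by apply/funext => h; apply: deltaE; rewrite size_tuple.
apply: cmeasurableM; [apply: cmeasurableM; [apply: cmeasurableM;
  [apply: cmeasurableM|]|]|].
- by apply: cmeasurable_mufun => i; exact: measurable_nth.
- apply: cmeasurable_Cexp; apply: cmeasurableM; last exact: cmeasurable_cst.
  by apply: cmeasurableM; [exact: cmeasurable_cst|exact: cmeasurable_real].
- apply: cmeasurable_Cexp; apply: cmeasurableM; last exact: cmeasurable_cst.
  by apply: cmeasurableN; apply: cmeasurableM;
    [exact: cmeasurable_real|exact: cmeasurable_cst].
- apply: cmeasurable_prod => p _; apply: cmeasurable_prod => j _.
  apply: cmeasurable_Gamma_half; first exact: measurable_cst.
  by apply: measurable_funN; exact: measurable_nth.
- apply: cmeasurable_prod => p _; apply: cmeasurable_prod => j _.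
  by apply: cmeasurable_Gamma_half; [exact: measurable_cst|exact: measurable_nth].
Qed.

End integrands.

(** * Exponential bounds for the factors of the integrand *)

Section exponential_bounds.
Context {R : realType}.
Implicit Types (z w : R[i]) (C E : R).

(** The constant and the exponent are tracked apart: in a product constants multiply and exponents
    add, so the constant stays independent of the integration point. *)
Definition ebound z C E := 0 <= C /\ normc z <= C * expR E.

Lemma eboundM z w C C' E E' : ebound z C E -> ebound w C' E' ->
  ebound (z * w) (C * C') (E + E').
Proof.
move=> [C0 zC] [C0' wC]; split; first exact: mulr_ge0.
rewrite ComplexField.Normc.normcM expRD mulrACA.
by apply: ler_pM => //; exact: normc_ge0.
Qed.

Lemma ebound_prod I (s : seq I) (P : pred I) (f : I -> R[i]) (C E : I -> R) :
  (forall i, P i -> ebound (f i) (C i) (E i)) ->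
  ebound (\prod_(i <- s | P i) f i) (\prod_(i <- s | P i) C i) (\sum_(i <- s | P i) E i).
Proof.
move=> H; elim: s => [|i s IH].
  by rewrite !big_nil; split => //; rewrite ComplexField.Normc.normc1 expR0 mulr1.
by rewrite !big_cons; case: ifPn => // Pi; apply: eboundM => //; exact: H.
Qed.

Lemma distD_max (x y : R) : `|x - y| + `|x + y| = 2 * Num.max `|x| `|y|.
Proof.
have [x0|x0] := leP 0 x; have [y0|y0] := leP 0 y;
  have [xy|xy] := leP 0 (x - y); have [xy'|xy'] := leP 0 (x + y);
  rewrite ?(ger0_norm x0) ?(ltr0_norm x0) ?(ger0_norm y0) ?(ltr0_norm y0)
    ?(ger0_norm xy) ?(ltr0_norm xy) ?(ger0_norm xy') ?(ltr0_norm xy');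
  case: leP => ?; lra.
Qed.

Lemma sum_max_nth (S T : seq R) k l : size S = k -> size T = l ->
  sum_max (map Num.norm S) (map Num.norm T) =
  \sum_(p < k) \sum_(q < l) Num.max `|S`_p| `|T`_q|.
Proof.
move=> <- <-; rewrite /sum_max big_map (big_nth 0) big_mkord.
by apply: eq_bigr => p _; rewrite big_map (big_nth 0) big_mkord.
Qed.

Lemma sum_triangle (h : nat -> nat -> R) k : (forall r s, h r s = h s r) ->
  \sum_(s < k) \sum_(r < s) 2 * h r s =
  \sum_(s < k) \sum_(r < k) h s r - \sum_(s < k) h s s.
Proof.
move=> hC; elim: k => [|k IH]; first by rewrite !big_ord0 subr0.
rewrite !big_ord_recr /= IH.
under [X in _ = X + _ - _]eq_bigr do rewrite big_ord_recr /=.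
rewrite big_split /= -mulr_sumr.
rewrite [X in _ + X - _](_ : _ = \sum_(i < k) h i k + h k k); last first.
  by congr (_ + _); apply: eq_bigr => i _; exact: hC.
by ring.
Qed.

End exponential_bounds.

Section integrand_bounds.
Context {R : realType}.
(** The rates will be [k1 = (pi + e) / c] and [k2 = (pi - e) / c]; the loss [e] weakens both the
    growth bound and the decay bound. *)
Variables (c C k1 k2 : R).
Hypothesis C_gt0 : 0 < C.
Hypothesis GammaV2_0_le : forall y,
  normc (Gamma (y%:C / (0 +i* c))) ^- 2 <= C * expR (k1 * `|y|).
Hypothesis GammaV2_1_le : forall y,
  normc (Gamma (1 + y%:C / (0 +i* c))) ^- 2 <= C * expR (k1 * `|y|).
Hypothesis Gamma_half_line_le : forall y,
  normc (Gamma (y%:C / (0 +i* c) + 2%:R^-1)) <= C * expR (- (k2 / 2) * `|y|).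

Lemma normc_normV2 (z : R[i]) : normc (`|z| ^- 2) = normc z ^- 2.
Proof.
rewrite ComplexField.Normc.normcV normr_normc -rmorphXn normc_real ger0_norm//.
by rewrite sqr_ge0.
Qed.

Lemma ebound_GammaV2_0 y :
  ebound (`|Gamma (y%:C / (0 +i* c))| ^- 2) C (k1 * `|y|).
Proof. by split; rewrite ?normc_normV2// ltW. Qed.

Lemma ebound_GammaV2_1 y :
  ebound (`|Gamma (1 + y%:C / (0 +i* c))| ^- 2) C (k1 * `|y|).
Proof. by split; rewrite ?normc_normV2// ltW. Qed.

Lemma ebound_Gamma_half u v :
  ebound (Gamma_half c u v) (C * C) (- (k2 * Num.max `|u| `|v|)).
Proof.
rewrite (_ : - _ = - (k2 / 2) * `|u + v| + - (k2 / 2) * `|u - v|); last first.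
  by rewrite -mulrDr [_ + `|u - v|]addrC distD_max; field.
have C0 := ltW C_gt0.
rewrite /Gamma_half /Gamma_pm; apply: eboundM; split => //.
  have := Gamma_half_line_le (u + v).
  by rewrite rmorphD mulrDl addrA.
have := Gamma_half_line_le (v - u).
by rewrite rmorphB mulrDl mulNr distrC addrA (addrC (- _)).
Qed.

Definition mu_cst a : R := if odd a
  then \prod_(s < a./2.+1) \prod_(r < s) (C * C)
  else (\prod_(s < a./2) \prod_(r < s) (C * C)) * \prod_(r < a./2) C.

Lemma ebound_pairs (g : seq R) k : size g = k ->
  \sum_(s < k) \sum_(r < s) (k1 * `|g`_r - g`_s| + k1 * `|g`_r + g`_s|) =
  k1 * (sum_max (map Num.norm g) (map Num.norm g) - \sum_(y <- map Num.norm g) y).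
Proof.
move=> sg; rewrite (sum_max_nth sg sg).
have -> : \sum_(y <- map Num.norm g) y = \sum_(s < k) Num.max `|g`_s| `|g`_s|.
  rewrite big_map (big_nth 0) big_mkord sg.
  by apply: eq_bigr => i _; rewrite maxxx.
rewrite -(@sum_triangle _ (fun r s => Num.max `|g`_r| `|g`_s|)); last first.
  by move=> r s; exact: maxC.
rewrite mulr_sumr; apply: eq_bigr => s _; rewrite mulr_sumr; apply: eq_bigr => r _.
by rewrite -mulrDr distD_max.
Qed.

Lemma ebound_mufun a (g : seq R) : (0 < a)%N -> size g = uphalf a ->
  ebound (mufun c a g) (mu_cst a) (k1 * measure_expo a (map Num.norm g)).
Proof.
move=> a0 sg; rewrite /mufun /mu_cst /measure_expo; case: ifPn => ao.
  have sg' : size g = a./2.+1.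
    by rewrite sg uphalf_half ao.
  rewrite -(ebound_pairs sg').
  apply: ebound_prod => s _; apply: ebound_prod => r _.
  by apply: eboundM; [exact: ebound_GammaV2_0|exact: ebound_GammaV2_1].
have sg' : size g = a./2 by rewrite sg uphalf_half (negbTE ao).
rewrite (_ : k1 * _ = k1 * (sum_max (map Num.norm g) (map Num.norm g) -
    \sum_(y <- map Num.norm g) y) + \sum_(r < a./2) k1 * `|2%:R * g`_r|); last first.
  have -> : \sum_(r < a./2) k1 * `|2%:R * g`_r| = k1 * (2 * \sum_(y <- map Num.norm g) y).
    rewrite big_map (big_nth 0) big_mkord sg' !mulr_sumr.
    by apply: eq_bigr => i _; rewrite normrM ger0_norm.
  by ring.
rewrite -(ebound_pairs sg'); apply: eboundM.
  apply: ebound_prod => s _; apply: ebound_prod => r _.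
  by apply: eboundM; exact: ebound_GammaV2_0.
by apply: ebound_prod => r _; exact: ebound_GammaV2_0.
Qed.

Lemma ebound_Gamma_block (S T : seq R) k l : size S = k -> size T = l ->
  ebound (\prod_(p < k) \prod_(j < l) Gamma_half c S`_p T`_j)
    (\prod_(p < k) \prod_(j < l) (C * C))
    (- (k2 * sum_max (map Num.norm S) (map Num.norm T))).
Proof.
move=> sS sT; rewrite (sum_max_nth sS sT) mulr_sumr -sumrN.
apply: ebound_prod => p _; rewrite mulr_sumr -sumrN.
by apply: ebound_prod => j _; exact: ebound_Gamma_half.
Qed.

Lemma ebound_Gamma_blockN (S T : seq R) k l : size S = k -> size T = l ->
  ebound (\prod_(p < k) \prod_(j < l) Gamma_half c S`_p (- T`_j))
    (\prod_(p < k) \prod_(j < l) (C * C))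
    (- (k2 * sum_max (map Num.norm S) (map Num.norm T))).
Proof.
move=> sS sT; rewrite (sum_max_nth sS sT) mulr_sumr -sumrN.
apply: ebound_prod => p _; rewrite mulr_sumr -sumrN.
apply: ebound_prod => j _; rewrite -(normrN T`_j); exact: ebound_Gamma_half.
Qed.

End integrand_bounds.

(** * Layout of the levels inside a point of [R^(m^2)] *)

Section levels.
Context {R : realType}.
Implicit Types (a m N : nat).

Lemma level_offsetS a : ((a.+1)./2 * uphalf a.+1 = a./2 * uphalf a + uphalf a)%N.
Proof. by rewrite -uphalfE (_ : uphalf a.+1 = a./2.+1)// mulnS mulnC addnC. Qed.

Lemma level_fits a m : (a < m.*2)%N -> (a./2 * uphalf a + uphalf a <= m ^ 2)%N.
Proof.
move=> am; have h1 : (a./2 < m)%N by rewrite ltn_half_double.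
have h2 : (uphalf a <= m)%N by lia.
by rewrite -mulSnr -mulnn leq_mul.
Qed.

Lemma size_level_eq m (t : (m ^ 2).-tuple R) a :
  (a < m.*2)%N -> size (level t a) = uphalf a.
Proof.
move=> /level_fits am; rewrite /level size_takel// size_drop size_tuple.
by rewrite leq_subRL ?(leq_trans (leq_addr _ _) am).
Qed.

Lemma between_offsets (f : nat -> nat) N j : (f 0 <= j < f N)%N ->
  exists2 a, (a < N)%N & (f a <= j < f a.+1)%N.
Proof.
elim: N => [|N IH] /andP[h1 h2]; first by move: (leq_ltn_trans h1 h2); rewrite ltnn.
have [jN|Nj] := ltnP j (f N).
  by have [|a aN ja] := IH; [rewrite h1|exists a => //; exact: ltnW].
by exists N => //; rewrite Nj.
Qed.

(** The offsets of the levels [0, ..., 2m] increase from 0 to [m^2] without gaps. Bounds on the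
    levels therefore reach every integration variable. *)
Lemma mem_level m (t : (m ^ 2).-tuple R) j : (j < m ^ 2)%N ->
  exists2 a, (a < m.*2)%N & t`_j \in level t a.
Proof.
move=> jm; pose off a := (a./2 * uphalf a)%N.
have [|a am /andP[aj ja]] := @between_offsets off m.*2 j.
  by rewrite /off /= doubleK uphalf_double mulnn.
exists a => //; rewrite /off level_offsetS in ja aj.
have jl : (j - off a < uphalf a)%N by rewrite ltn_subLR.
have -> : t`_j = (level t a)`_(j - off a).
  by rewrite /level nth_take// nth_drop subnKC.
by apply: mem_nth; rewrite size_level_eq.
Qed.

End levels.

Section complex_exponents.
Context {R : realType}.
Variable c : R.
Hypothesis c_gt0 : 0 < c.

Lemma ic_neq0 : 0 +i* c != 0.
Proof. by rewrite eq_complex /= eqxx /= gt_eqF. Qed.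

Lemma div_ic (y : R) : y%:C / (0 +i* c) = 0 +i* (- y / c).
Proof.
apply: (canLR (mulfK ic_neq0)); apply/eqP; rewrite eq_complex /=.
have c0 : c != 0 by rewrite gt_eqF.
by rewrite !(mul0r, mulr0, sub0r, addr0) divfK// opprK !eqxx.
Qed.

(** Separates a phase, of modulus 1 after exponentiation when [c > 0], from a real part that does
    not involve the integration variables. *)
Lemma Whittaker_exponent n (d x : nat -> R) :
  (0 +i* c)^-1 * (\sum_(1 <= k < n) ((d k)%:C + k.-1%:R * (0 +i* c)) * (x k)%:C) =
  (\sum_(1 <= k < n) d k * x k)%:C / (0 +i* c) +
  (\sum_(1 <= k < n) k.-1%:R * x k)%:C.
Proof.
rewrite !rmorph_sum /= mulr_sumr mulr_suml -big_split /=.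
apply: eq_bigr => k _; rewrite !rmorphM /= rmorph_nat.
by have := ic_neq0; move: (0 +i* c) => z z0; field.
Qed.

Lemma normc_Cpow (y : R) : normc (Cpow c (2%:R / (0 +i* c) * y%:C)) = 1.
Proof.
rewrite /Cpow normc_Cexp -(expR0 R); congr expR.
rewrite (_ : _ * _ = (2 * y * ln c)%:C / (0 +i* c)); first by rewrite div_ic.
by rewrite !rmorphM /= rmorph_nat; ring.
Qed.

Lemma Gamma_constants (e : R) : 0 < e -> exists2 C, 0 < C &
  [/\ forall y, normc (Gamma (y%:C / (0 +i* c))) ^- 2 <= C * expR ((pi + e) / c * `|y|),
      forall y, normc (Gamma (1 + y%:C / (0 +i* c))) ^- 2 <= C * expR ((pi + e) / c * `|y|) &
      forall y, normc (Gamma (y%:C / (0 +i* c) + 2%:R^-1)) <=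
        C * expR (- ((pi - e) / c / 2) * `|y|)].
Proof.
move=> e0; have e20 : 0 < e / 2 by rewrite divr_gt0.
have [C0 C00 H0] := normc_GammaV2_0_le e0.
have [C1 C10 H1] := normc_GammaV2_1_le e0.
have [C2 C20 H2] := normc_Gamma_half_le e20.
have nE (y : R) : `|- y / c| = `|y| / c.
  by rewrite mulNr normrN normrM (ger0_norm (_ : 0 <= c^-1)) ?invr_ge0 ?ltW.
have C0' := ltW C00; have C1' := ltW C10; have C2' := ltW C20.
exists (C0 + C1 + C2); first by rewrite !addr_gt0.
split=> y; rewrite div_ic.
- apply: (le_trans (H0 _)); rewrite nE mulrA [(_ + e) / c * _]mulrAC.
  by rewrite ler_wpM2r ?expR_ge0//; lra.
- rewrite (_ : 1 + _ = 1 +i* (- y / c)); last first.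
    by apply/eqP; rewrite eq_complex /= addr0 add0r !eqxx.
  apply: (le_trans (H1 _)); rewrite nE mulrA [(_ + e) / c * _]mulrAC.
  by rewrite ler_wpM2r ?expR_ge0//; lra.
- rewrite (_ : _ + _ = 2^-1 +i* (- y / c)); last first.
    rewrite -(rmorph_nat (real_complex R)) -fmorphV.
    by apply/eqP; rewrite eq_complex /= addr0 add0r !eqxx.
  apply: (le_trans (H2 _)); rewrite nE.
  rewrite (_ : - (pi / 2 - e / 2) * (`|y| / c) = - ((pi - e) / c / 2) * `|y|).
    by rewrite ler_wpM2r ?expR_ge0//; lra.
  by field; rewrite gt_eqF.
Qed.

End complex_exponents.

(** * Absolute convergence of the Whittaker integral *)

Section Whittaker_bound.
Context {R : realType}.
Variable c : R.
Hypothesis c_gt0 : 0 < c.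
Variables (m : nat) (g x : m.-tuple R).
Hypothesis m_gt0 : (0 < m)%N.

Definition all_levels (t : (m ^ 2).-tuple R) a : seq R :=
  map Num.norm (if (a < m.*2)%N then level t a else g).

Lemma size_all_levels t a : (a <= m.*2)%N -> size (all_levels t a) = uphalf a.
Proof.
move=> am; rewrite /all_levels size_map; case: ltnP => [|ma].
  exact: size_level_eq.
have -> : a = m.*2 by apply/eqP; rewrite eqn_leq am.
by rewrite size_tuple uphalf_double.
Qed.

Lemma all_levels_ge0 t a y : y \in all_levels t a -> 0 <= y.
Proof. by move=> /mapP[z _ ->]. Qed.

Lemma ebound_prod_nat (f : nat -> R[i]) (C E : nat -> R) a b :
  (forall i, (a <= i < b)%N -> ebound (f i) (C i) (E i)) ->
  ebound (\prod_(a <= i < b) f i) (\prod_(a <= i < b) C i) (\sum_(a <= i < b) E i).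
Proof. by move=> H; rewrite !big_nat; exact: ebound_prod. Qed.

Lemma ebound_Whittaker_integrand (e : R) : 0 < e -> exists K, forall t,
  ebound (Whittaker_integrand c g x t) K
   ((pi + e) / c * (\sum_(1 <= a < m.*2) measure_expo a (all_levels t a)) -
    (pi - e) / c * gamma_expo m (all_levels t) +
    \sum_(1 <= k < m.+1) k.-1%:R * x`_k.-1).
Proof.
move=> /(Gamma_constants c_gt0)[C C0 [H0 H1 H2]].
(* The constant is assembled by unification from the factors; being introduced before [t], it cannot
   depend on [t]. *)
eexists => t; rewrite /Whittaker_integrand.
set k1 := (pi + e) / c; set k2 := (pi - e) / c.
set xx := \sum_(1 <= k < m.+1) k.-1%:R * x`_k.-1.
(* One summand for each of the five factors of the integrand; the power of [c] has modulus 1, hence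
   the 0. *)
rewrite (_ : _ + xx = k1 * (\sum_(1 <= a < m.*2) measure_expo a (all_levels t a)) + 0 + xx +
   \sum_(1 <= k < m) (- (k2 * sum_max (all_levels t k.*2) (all_levels t k.*2.-1)) +
                     - (k2 * sum_max (all_levels t k.*2) (all_levels t k.*2.+1))) +
   - (k2 * sum_max (all_levels t m.*2) (all_levels t m.*2.-1))); last first.
  rewrite /gamma_expo [X in _ = _ + X - _](_ : _ = - k2 *
    \sum_(1 <= k < m) (sum_max (all_levels t k.*2) (all_levels t k.*2.-1) +
      sum_max (all_levels t k.*2) (all_levels t k.*2.+1))); first by ring.
  by rewrite mulr_sumr; apply: eq_bigr => k _; ring.
have lv a : (a < m.*2)%N -> all_levels t a = map Num.norm (level t a).
  by rewrite /all_levels => ->.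
apply: eboundM; last first.
  rewrite /all_levels ltnn (_ : m.*2.-1 < m.*2)%N; last by lia.
  apply: (ebound_Gamma_block C0 H2); first exact: size_tuple.
  by rewrite size_level_eq; lia.
apply: eboundM; last first.
  apply: ebound_prod_nat => k /andP[k1' km].
  rewrite big_split /= !lv; [|lia|lia|lia].
  apply: eboundM.
    by apply: (ebound_Gamma_block C0 H2); rewrite size_level_eq; lia.
  by apply: (ebound_Gamma_blockN C0 H2); rewrite size_level_eq; lia.
apply: eboundM; last first.
  split; last first.
    rewrite normc_Cexp Whittaker_exponent// div_ic//=.
    rewrite add0r -[X in X <= _]mul1r; apply: lexx.
  exact: ler01.
apply: eboundM; last first.
  split; last first.
    by rewrite normc_Cpow// expR0 mulr1; apply: lexx.
  exact: ler01.
rewrite mulr_sumr; apply: ebound_prod_nat => a /andP[a0 am].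
rewrite lv//; apply: (ebound_mufun C0 H0 H1) => //.
exact: size_level_eq.
Qed.

Lemma Whittaker_integrand_le : exists K, forall t,
  normc (Whittaker_integrand c g x t) <= K * lweight t.
Proof.
have [B B0 HB] := @expo_bound R m.
have pi0 := pi_gt0 R.
(* The loss is then at most [e / c * (B * V) = pi / (4 c) * V], half of the decay [pi / (2 c) * V]
   given by [measure_gamma_expo_le], where [V] is the variation of the maxima. *)
pose e : R := pi / (4 * B); have e0 : 0 < e by rewrite divr_gt0// mulr_gt0.
have [K HK] := ebound_Whittaker_integrand e0.
(* The remaining decay [pi / (4 c) * V] is shared equally among the [m^2] coordinates, none of which
   exceeds [V] in absolute value. *)
pose eta : R := pi / (4 * c) / (m ^ 2)%:R.
have m20 : (0 < m ^ 2)%N by rewrite expn_gt0 m_gt0.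
have eta0 : 0 < eta by rewrite divr_gt0 ?ltr0n// divr_gt0// mulr_gt0.
have [D D0 HD] := poly_le_expR eta0.
pose top : seq R := map Num.norm g.
pose E0 := pi / c * (2^-1 * sum_min top top) + \sum_(1 <= k < m.+1) k.-1%:R * x`_k.-1.
exists (K * expR E0 * D ^+ (m ^ 2)) => t.
have [K0 /le_trans] := HK t; apply.
pose L := all_levels t; pose V := max_variation m L.
have sL a : (a <= m.*2)%N -> size (L a) = uphalf a by exact: size_all_levels.
have L0 a y : (a <= m.*2)%N -> y \in L a -> 0 <= y by move=> _; exact: all_levels_ge0.
have LV a y : (a <= m.*2)%N -> y \in L a -> y <= V.
  by apply: le_max_variation; exact/size0nil/sL.
have V0 : 0 <= V by apply: sumr_ge0.
have LT : L m.*2 = top by rewrite /L /all_levels ltnn.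
have h1 := measure_gamma_expo_le m_gt0 sL L0; rewrite -/V LT in h1.
have h2 : \sum_(1 <= a < m.*2) measure_expo a (L a) + gamma_expo m L <= B * V.
  by apply: HB => // a y am ya; rewrite (L0 a)//= (LV a).
rewrite -!mulrA ler_wpM2l//.
apply: (@le_trans _ _ (expR (E0 - pi / (4 * c) * V))).
  rewrite ler_expR /E0 [leRHS]addrAC lerD2r -/L.
  move: h1 h2.
  move: (\sum_(1 <= a < _) _) (gamma_expo m L) (sum_min top top) => P G M h1 h2.
  have c0 : c != 0 by rewrite gt_eqF.
  have B0' : B != 0 by rewrite gt_eqF.
  rewrite (_ : _ - _ = pi / c * (P - G) + e / c * (P + G)); last by field.
  rewrite (_ : pi / c * (2^-1 * M) - _ =
      pi / c * (2^-1 * M - 2^-1 * V) + e / c * (B * V)); last first.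
    by rewrite /e; field; rewrite B0' c0.
  by apply: lerD; rewrite ler_wpM2l// divr_ge0 ?ltW.
rewrite expRD ler_wpM2l ?expR_ge0//.
apply: (@le_trans _ _ (expR (\sum_(y <- t) - (eta * `|y|)))).
  rewrite ler_expR sumrN lerN2.
  rewrite (big_nth 0) size_tuple big_mkord.
  apply: (@le_trans _ _ (\sum_(j < m ^ 2) eta * V)).
    apply: ler_sum => j _; rewrite ler_wpM2l ?(ltW eta0)//.
    have [a am ta] := mem_level t (ltn_ord j).
    apply: (LV a); first exact: ltnW.
    by rewrite /L /all_levels am; exact: map_f.
  rewrite sumr_const card_ord -[leLHS]mulr_natl /eta.
  rewrite le_eqVlt; apply/orP; left; apply/eqP.
  have : (m ^ 2)%:R != 0 :> R by rewrite pnatr_eq0 -lt0n.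
  by move: ((m ^ 2)%:R : R) => u u0; field; rewrite u0 gt_eqF.
(* Coordinate by coordinate, [expR (- eta |y|) <= D / (1 + y^2)] by the choice of [D]. *)
rewrite expR_sum -[X in D ^+ X](size_tuple t) /lweight.
have -> : D ^+ size t * \prod_(y <- t) (1 + y ^+ 2)^-1 = \prod_(y <- t) (D / (1 + y ^+ 2)).
  by rewrite big_split /= big_const_seq count_predT -Monoid.iteropE.
apply: ler_prod => y _; rewrite expR_ge0/= expRN.
rewrite ler_pdivlMr; last by rewrite ltr_pwDl ?sqr_ge0.
by rewrite mulrC ler_pdivrMr ?expR_gt0.
Qed.

End Whittaker_bound.

(** * Factorization of the integrand *)

Section factorization.
Context {R : realType}.
Variable c : R.
Hypothesis c_gt0 : 0 < c.

Lemma CexpD (z w : R[i]) : Cexp (z + w) = Cexp z * Cexp w.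
Proof.
case: z w => a b [a' b']; rewrite /Cexp /= expRD cosD sinD.
by apply/eqP; rewrite eq_complex /=; apply/andP; split; apply/eqP; ring.
Qed.

Lemma Cexp_real (y : R) : Cexp y%:C = (expR y)%:C.
Proof.
rewrite /Cexp /= cos0 sin0; apply/eqP; rewrite eq_complex /=.
by rewrite !(mulr1, mulr0, mul0r) subr0 addr0 !eqxx.
Qed.

Lemma CpowD (z w : R[i]) : Cpow c (z + w) = Cpow c z * Cpow c w.
Proof. by rewrite /Cpow mulrDl CexpD. Qed.

Lemma sum_ord_natr m : \sum_(i < m) i%:R = (m * m.-1)%:R / 2%:R :> R.
Proof.
elim: m => [|m IH]; first by rewrite big_ord0 mul0r.
rewrite big_ord_recr /= {}IH; case: m => [|m]; first by rewrite mul0r addr0.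
by rewrite /= !natrM -!natr1; field.
Qed.

Definition odd_delta (s : seq R) k : R :=
  if k is k'.+1 then delta (level s k'.*2.+1) else 0.

Lemma level_cat (m : nat) (u : (m ^ 2).-tuple R) (s : seq R) a :
  (a < m.*2)%N -> level (u ++ s) a = level u a.
Proof.
move=> /level_fits am; rewrite /level drop_cat size_tuple.
have au : (a./2 * uphalf a <= m ^ 2)%N by exact: leq_trans (leq_addr _ _) am.
case: ltnP => h.
  by rewrite takel_cat// size_drop size_tuple leq_subRL.
have a0 : uphalf a = 0%N by lia.
by rewrite a0 !take0.
Qed.

Section split_point.
(** For rank [m + 1]: [u] holds the levels below [2m], [v] level [2m] and [w] level [2m + 1]. The
    whole point is the plain list [s], which keeps tuple casts out of the computations. *)
Variables (m : nat) (g x : m.+1.-tuple R).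
Variables (u : (m ^ 2).-tuple R) (v : m.-tuple R) (w : m.+1.-tuple R) (s : seq R).
Hypothesis m_gt0 : (0 < m)%N.
Hypothesis sE : s = (u ++ v) ++ w.

Lemma level_split_lt a : (a < m.*2)%N -> level s a = level u a.
Proof. by move=> am; rewrite sE -catA level_cat. Qed.

Lemma level_split_even : level s m.*2 = v.
Proof.
rewrite /level doubleK uphalf_double sE -catA.
have -> : (m * m = size u)%N by rewrite size_tuple mulnn.
by rewrite drop_size_cat// take_size_cat// size_tuple.
Qed.

Lemma level_split_odd : level s m.*2.+1 = w.
Proof.
rewrite /level /= doubleK uphalf_double sE.
have -> : (m * m.+1 = size (u ++ v))%N by rewrite size_cat !size_tuple; lia.
by rewrite drop_size_cat// take_oversize// size_tuple.
Qed.

Lemma odd_delta_split k : (k <= m)%N -> odd_delta s k = odd_delta u k.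
Proof. by case: k => // k km; rewrite /= level_split_lt//; lia. Qed.

Lemma odd_delta_split_last : odd_delta s m.+1 = delta w.
Proof. by rewrite /= level_split_odd. Qed.

Let y : R := x`_m.
Let x' : m.-tuple R := [tuple x`_k - x`_m | k < m].

Let x'E k : (1 <= k < m.+1)%N -> x'`_k.-1 = x`_k.-1 - y.
Proof.
case: k => // k /= km; have km' : (k < m)%N by [].
by rewrite -(tnth_nth 0 x' (Ordinal km')) tnth_mktuple.
Qed.

(** Shifting the first [m] variables by [y] produces a telescoping sum [- odd_delta u m * y], which
    cancels against the last summand and leaves only [- delta w * y]. In the real part the shift
    gives [m (m - 1) / 2 * y], and the last summand [m * y] completes it to the prefactor of the
    kernel. *)
Lemma Whittaker_exponent_split :
  Cexp ((0 +i* c)^-1 * \sum_(1 <= k < m.+2)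
    ((odd_delta s k.-1 - odd_delta s k)%:C + k.-1%:R * (0 +i* c)) * (x`_k.-1)%:C) =
  Cexp ((0 +i* c)^-1 * \sum_(1 <= k < m.+1)
    ((odd_delta u k.-1 - odd_delta u k)%:C + k.-1%:R * (0 +i* c)) * (x'`_k.-1)%:C) *
  Cexp (- ((delta w)%:C / (0 +i* c)) * y%:C) *
  (expR ((m.+1 * m)%:R / 2%:R * y))%:C.
Proof.
rewrite -Cexp_real -!CexpD; congr Cexp.
rewrite !(Whittaker_exponent c_gt0).
have -> : \sum_(1 <= k < m.+2) (odd_delta s k.-1 - odd_delta s k) * x`_k.-1 =
   \sum_(1 <= k < m.+1) (odd_delta u k.-1 - odd_delta u k) * x'`_k.-1 - delta w * y.
  rewrite big_nat_recr//= -/(odd_delta s m.+1) odd_delta_split_last odd_delta_split//.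
  have tel : \sum_(1 <= k < m.+1) (odd_delta u k.-1 - odd_delta u k) * y = - odd_delta u m * y.
    rewrite -mulr_suml; congr (_ * _); rewrite big_add1 /=.
    have := telescope_sumr (odd_delta u) (leq0n m); rewrite subr0 => <-.
    by rewrite -sumrN; apply: eq_bigr => k _; rewrite opprB.
  rewrite [RHS](_ : _ = \sum_(1 <= k < m.+1) (odd_delta u k.-1 - odd_delta u k) * x`_k.-1
     - \sum_(1 <= k < m.+1) (odd_delta u k.-1 - odd_delta u k) * y - delta w * y); last first.
    congr (_ - _); rewrite -sumrB big_nat [RHS]big_nat; apply: eq_bigr => k km.
    by rewrite x'E// mulrBr.
  rewrite tel mulrBl mulNr opprK -!addrA; congr (_ + _).
  rewrite big_nat [RHS]big_nat; apply: eq_bigr => k /andP[k1 km].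
  by rewrite !odd_delta_split//; lia.
have -> : \sum_(1 <= k < m.+2) k.-1%:R * x`_k.-1 =
   \sum_(1 <= k < m.+1) k.-1%:R * x'`_k.-1 + (m.+1 * m)%:R / 2%:R * y :> R.
  rewrite big_nat_recr//=.
  have gauss : \sum_(1 <= k < m.+1) (k.-1%:R : R) * y = (m * m.-1)%:R / 2%:R * y.
    by rewrite -mulr_suml big_add1 /= big_mkord sum_ord_natr.
  rewrite [X in _ = X + _](_ : _ = \sum_(1 <= k < m.+1) k.-1%:R * x`_k.-1
     - \sum_(1 <= k < m.+1) k.-1%:R * y); last first.
    rewrite -sumrB big_nat [RHS]big_nat; apply: eq_bigr => k km.
    by rewrite x'E// mulrBr.
  have m1 : m.-1%:R = m%:R - 1 :> R by rewrite -subn1 natrB.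
  by rewrite gauss !natrM m1 -(natr1 m) -/y; field.
rewrite !rmorphD !rmorphN !rmorphM /=.
by have := ic_neq0 c_gt0; move: (0 +i* c) => z z0; field.
Qed.

Lemma prod_mufun_split : \prod_(1 <= a < m.+1.*2) mufun c a (level s a) =
  \prod_(1 <= a < m.*2) mufun c a (level u a) * mufun c m.*2 v * mufun c m.*2.+1 w.
Proof.
have m2 : (1 <= m.*2)%N by rewrite double_gt0.
rewrite doubleS (big_nat_recr _ _ _ (leqW m2)) (big_nat_recr _ _ _ m2).
rewrite level_split_even level_split_odd.
rewrite (@eq_big_nat _ _ _ _ _ _ (fun a => mufun c a (level u a))) // => a /andP[_ am].
by rewrite level_split_lt.
Qed.

Lemma sum_odd_delta_split :
  \sum_(1 <= k < m.+2) odd_delta s k = \sum_(1 <= k < m.+1) odd_delta u k + delta w.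
Proof.
rewrite big_nat_recr// odd_delta_split_last.
rewrite (@eq_big_nat _ _ _ _ _ _ (odd_delta u)) // => k /andP[_ km].
exact: odd_delta_split.
Qed.

(** The index [k = m] straddles the cut: its product with level [2m - 1] is the closing product of
    the Whittaker function with parameters [v], its product with level [2m + 1] belongs to the
    kernel. *)
Lemma prod_Gamma_half_split :
  \prod_(1 <= k < m.+1) \prod_(p < k)
     ((\prod_(j < k) Gamma_half c (level s k.*2)`_p (level s k.*2.-1)`_j) *
      \prod_(l < k.+1) Gamma_half c (level s k.*2)`_p (- (level s k.*2.+1)`_l)) =
  \prod_(1 <= k < m) \prod_(p < k)
     ((\prod_(j < k) Gamma_half c (level u k.*2)`_p (level u k.*2.-1)`_j) *
      \prod_(l < k.+1) Gamma_half c (level u k.*2)`_p (- (level u k.*2.+1)`_l)) *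
  ((\prod_(p < m) \prod_(j < m) Gamma_half c v`_p (level u m.*2.-1)`_j) *
   \prod_(p < m) \prod_(l < m.+1) Gamma_half c v`_p (- w`_l)).
Proof.
have m2 : (m.*2.-1 < m.*2)%N by lia.
rewrite (big_nat_recr _ _ _ m_gt0) -big_split /= level_split_even level_split_odd.
rewrite (level_split_lt m2).
set F := fun k : nat => \prod_(p < k)
     ((\prod_(j < k) Gamma_half c (level u k.*2)`_p (level u k.*2.-1)`_j) *
      \prod_(l < k.+1) Gamma_half c (level u k.*2)`_p (- (level u k.*2.+1)`_l)).
rewrite (@eq_big_nat _ _ _ _ _ _ F) // => k /andP[k1 km].
rewrite (@level_split_lt k.*2) ?(@level_split_lt k.*2.-1) ?(@level_split_lt k.*2.+1)//; lia.
Qed.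

Lemma Whittaker_integrand_split (t : (m.+1 ^ 2).-tuple R) : tval t = s ->
  Whittaker_integrand c g x t =
  mufun c m.*2 v * Whittaker_integrand c v x' u *
  ((expR ((m.+1 * m)%:R / 2%:R * y))%:C * kernel_integrand c g v y w).
Proof.
move=> ts; rewrite /Whittaker_integrand /kernel_integrand ts -/(odd_delta s) -/(odd_delta u).
have -> : \prod_(1 <= a < m.+1.*2) mufun c a (level s a) =
   \prod_(1 <= a < m.*2) mufun c a (level u a) * mufun c m.*2 v * mufun c m.*2.+1 w.
  exact: prod_mufun_split.
have -> : Cpow c (2%:R / (0 +i* c) * (\sum_(1 <= k < m.+2) odd_delta s k)%:C) =
  Cpow c (2%:R / (0 +i* c) * (\sum_(1 <= k < m.+1) odd_delta u k)%:C) *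
  Cpow c (2%:R / (0 +i* c) * (delta w)%:C).
  rewrite -CpowD -mulrDr -rmorphD sum_odd_delta_split //.
rewrite Whittaker_exponent_split.
have -> : \prod_(1 <= k < m.+1) \prod_(p < k)
     ((\prod_(j < k) Gamma_half c (level s k.*2)`_p (level s k.*2.-1)`_j) *
      \prod_(l < k.+1) Gamma_half c (level s k.*2)`_p (- (level s k.*2.+1)`_l)) =
  \prod_(1 <= k < m) \prod_(p < k)
     ((\prod_(j < k) Gamma_half c (level u k.*2)`_p (level u k.*2.-1)`_j) *
      \prod_(l < k.+1) Gamma_half c (level u k.*2)`_p (- (level u k.*2.+1)`_l)) *
  ((\prod_(p < m) \prod_(j < m) Gamma_half c v`_p (level u m.*2.-1)`_j) *
   \prod_(p < m) \prod_(l < m.+1) Gamma_half c v`_p (- w`_l)).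
  exact: prod_Gamma_half_split.
rewrite doubleS /= level_split_odd.
by ring.
Qed.

End split_point.
End factorization.

Theorem mainTheorem3 (R : realType) (n : nat) (n_ge2 : (2 <= n)%N)
    (c : R) (c_gt0 : 0 < c) (gamma2n x : n.-tuple R) :
  Whittaker c gamma2n x =
  Cintegral (lebesgue_tuple R n.-1) (fun g : (n.-1).-tuple R =>
    Whittaker_kernel c gamma2n g x`_n.-1 *
    Whittaker c g [tuple x`_k - x`_n.-1 | k < n.-1] *
    mufun c (n.-1).*2 g).
Proof.
case: n n_ge2 gamma2n x => // m m_gt0 g x; have {}m_gt0 : (0 < m)%N by [].
have e : (m ^ 2 + m + m.+1 = m.+1 ^ 2)%N by rewrite -!mulnn; lia.
have [K HK] := Whittaker_integrand_le c_gt0 g x (ltn0Sn m).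
rewrite /Whittaker (Cintegral_tcat3 erefl e); last first.
  exact: cdominatedP (cmeasurable_Whittaker_integrand _ _ _) HK.
apply: eq_Cintegral => v.
pose k : R[i] := (expR ((m.+1 * m)%:R / 2%:R * x`_m))%:C.
pose a := Whittaker_integrand c v [tuple x`_j - x`_m | j < m].
pose b := kernel_integrand c g v x`_m.
pose M := mufun c m.*2 v.
have splitE u w : Whittaker_integrand c g x (tcat e (tcat erefl (u, v), w)) =
    M * a u * (k * b w).
  by apply: Whittaker_integrand_split => //; rewrite /tcat val_tcast /=.
transitivity (Cintegral (lebesgue_tuple R (m ^ 2)) (fun u =>
  Cintegral (lebesgue_tuple R m.+1) (fun w => M * a u * (k * b w)))).
  by apply: eq_Cintegral => u; apply: eq_Cintegral => w; exact: splitE.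
(* With [v] frozen, the bound on the full integrand is all that is required: it yields the kernel
   and the Whittaker function of rank [m] as separate factors. *)
apply: (@Cintegral_prod _ _ _ _ _ _ _ (K * lweight v)).
- exact: cmeasurable_Whittaker_integrand.
- exact: cmeasurable_kernel_integrand.
move=> u w; rewrite -splitE; apply: (le_trans (HK _)).
rewrite !lweight_tcat le_eqVlt; apply/orP; left; apply/eqP; ring.
Qed.
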